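(* Let $M = cQ + \varepsilon D \in \mathbb{DH}[t]$ be a bounded monic motion polynomial with $c \in \mathbb{R}[t]$, $Q \in \mathbb{H}[t]$, $D \in \mathbb{H}[t]$ such that both $M$ and $Q$ have only constant real polynomial factors. Let $g$ be the greatest common real (monic) polynomial divisor of the quaternion polynomials $c$, $Q^{*}D$, and $DQ^{*}$. Then $M$ admits a factorization with monic linear motion polynomial factors, i.e. $M = (t-h_1)(t-h_2)\cdots(t-h_n)$ with $n=\deg M$, $h_i\in\mathbb{DH}$ and each $t-h_i$ a motion polynomial, if and only if $cg$ divides $DD^{*}$.
   Context: $\mathbb{H}$ denotes the real quaternions, with conjugation $q=q_0+q_1\mathbf{i}+q_2\mathbf{j}+q_3\mathbf{k}\mapsto q^{*}=q_0-q_1\mathbf{i}-q_2\mathbf{j}-q_3\mathbf{k}$. The dual quaternions are $\mathbb{DH}=\mathbb{H}[\varepsilon]/(\varepsilon^2)$, where $\varepsilon$ commutes with everything; conjugation is $(p+\varepsilon d)^{*}=p^{*}+\varepsilon d^{*}$. In $\mathbb{DH}[t]$ and $\mathbb{H}[t]$ the indeterminate $t$ commutes with all coefficients, and $M^{*}$ is obtained by conjugating all coefficients. Every $M\in\mathbb{DH}[t]$ is uniquely $M=P+\varepsilon D$ with $P,D\in\mathbb{H}[t]$; $P$ is its primal part, $D$ its dual part. $M$ is a motion polynomial if $MM^{*}\in\mathbb{R}[t]\setminus\{0\}$. Monic means leading coefficient $1$; linear means degree $1$. A real polynomial $F$ divides $M\in\mathbb{DH}[t]$ if $M=FM'$ for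 some $M'\in\mathbb{DH}[t]$ (so every nonzero real polynomial divides $0$). $\operatorname{mrpf}(P)$ denotes the greatest monic real polynomial divisor of $P$ ($\operatorname{mrpf}(0):=1$). A polynomial $M$ is reduced if $\operatorname{mrpf}(M)=1$. A monic reduced motion polynomial $M=P+\varepsilon D$ is bounded if $\operatorname{mrpf}(P)$ has no real zero. *)

(* Defs.v *)
From HB Require Import structures.
From mathcomp Require Import all_boot all_order all_algebra.
From mathcomp Require Import ring.
From mathcomp Require Import boolp classical_sets reals.

Set Implicit Arguments.
Unset Strict Implicit.
Unset Printing Implicit Defensive.

Import GRing.Theory.
Local Open Scope ring_scope.

(* Quat a b c d is a + b i + c j + d k. *)
Record quat (R : Type) := Quat { q0 : R; q1 : R; q2 : R; q3 : R }.

Definition quat_to_prod (R : Type) (x : quat R) : R * R * R * R :=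
  (q0 x, q1 x, q2 x, q3 x).
Definition prod_to_quat (R : Type) (x : R * R * R * R) : quat R :=
  let: (a, b, c, d) := x in Quat a b c d.
Lemma quat_to_prodK R : cancel (@quat_to_prod R) (@prod_to_quat R).
Proof. by case. Qed.
HB.instance Definition _ (R : choiceType) :=
  Choice.copy (quat R) (can_type (@quat_to_prodK R)).

Section QuatRing.
Variable R : comNzRingType.
Implicit Types x y z : quat R.

Definition addq x y :=
  Quat (q0 x + q0 y) (q1 x + q1 y) (q2 x + q2 y) (q3 x + q3 y).
Definition oppq x := Quat (- q0 x) (- q1 x) (- q2 x) (- q3 x).
Definition mulq x y :=
  Quat (q0 x * q0 y - q1 x * q1 y - q2 x * q2 y - q3 x * q3 y)
       (q0 x * q1 y + q1 x * q0 y + q2 x * q3 y - q3 x * q2 y)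
       (q0 x * q2 y - q1 x * q3 y + q2 x * q0 y + q3 x * q1 y)
       (q0 x * q3 y + q1 x * q2 y - q2 x * q1 y + q3 x * q0 y).
Definition scaleq (a : R) x := Quat (a * q0 x) (a * q1 x) (a * q2 x) (a * q3 x).

Fact addqA : associative addq.
Proof. by move=> [????] [????] [????]; rewrite /addq /= !addrA. Qed.
Fact addqC : commutative addq.
Proof. by move=> [????] [????]; rewrite /addq /=; congr Quat; rewrite addrC. Qed.
Fact add0q : left_id (Quat 0 0 0 0) addq.
Proof. by move=> [????]; rewrite /addq /= !add0r. Qed.
Fact addNq : left_inverse (Quat 0 0 0 0) oppq addq.
Proof. by move=> [????]; rewrite /addq /oppq /= !addNr. Qed.
HB.instance Definition _ :=
  GRing.isZmodule.Build (quat R) addqA addqC add0q addNq.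

Fact mulqA : associative mulq.
Proof. by move=> [????] [????] [????]; congr Quat => /=; ring. Qed.
Fact mul1q : left_id (Quat 1 0 0 0) mulq.
Proof. by move=> [????]; congr Quat => /=; ring. Qed.
Fact mulq1 : right_id (Quat 1 0 0 0) mulq.
Proof. by move=> [????]; congr Quat => /=; ring. Qed.
Fact mulqDl : left_distributive mulq addq.
Proof. by move=> [????] [????] [????]; congr Quat => /=; ring. Qed.
Fact mulqDr : right_distributive mulq addq.
Proof. by move=> [????] [????] [????]; congr Quat => /=; ring. Qed.
Fact oneq_neq0 : Quat 1 0 0 0 != 0 :> quat R.
Proof. by apply/eqP => -[] /eqP; rewrite oner_eq0. Qed.
HB.instance Definition _ :=
  GRing.Zmodule_isNzRing.Build (quat R) mulqA mul1q mulq1 mulqDl mulqDr oneq_neq0.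

Fact scaleqA a b x : scaleq a (scaleq b x) = scaleq (a * b) x.
Proof. by case: x => *; congr Quat => /=; rewrite mulrA. Qed.
Fact scale1q : left_id 1 scaleq.
Proof. by case=> *; congr Quat => /=; rewrite mul1r. Qed.
Fact scaleqDr : right_distributive scaleq +%R.
Proof. by move=> a [????] [????]; congr Quat => /=; rewrite mulrDr. Qed.
Fact scaleqDl x : {morph scaleq^~ x : a b / a + b}.
Proof. by case: x => ???? a b; congr Quat => /=; rewrite mulrDl. Qed.
HB.instance Definition _ :=
  GRing.Zmodule_isLmodule.Build R (quat R) scaleqA scale1q scaleqDr scaleqDl.

Fact scaleqAl a x y : a *: (x * y) = (a *: x) * y.
Proof. by case: x => ????; case: y => ????; congr Quat => /=; ring. Qed.
HB.instance Definition _ := GRing.Lmodule_isLalgebra.Build R (quat R) scaleqAl.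
Fact scaleqAr a x y : a *: (x * y) = x * (a *: y).
Proof. by case: x => ????; case: y => ????; congr Quat => /=; ring. Qed.
HB.instance Definition _ := GRing.Lalgebra_isAlgebra.Build R (quat R) scaleqAr.

Definition conjq x : quat R := Quat (q0 x) (- q1 x) (- q2 x) (- q3 x).

End QuatRing.

(* Dual p d is p + eps d, in A[eps]/(eps^2). *)
Record dual (A : Type) := Dual { primal : A; dualp : A }.

Definition dual_to_prod (A : Type) (x : dual A) : A * A := (primal x, dualp x).
Definition prod_to_dual (A : Type) (x : A * A) : dual A := Dual x.1 x.2.
Lemma dual_to_prodK A : cancel (@dual_to_prod A) (@prod_to_dual A).
Proof. by case. Qed.
HB.instance Definition _ (A : choiceType) :=
  Choice.copy (dual A) (can_type (@dual_to_prodK A)).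

Section DualRing.
Variable A : nzRingType.
Implicit Types x y z : dual A.

Definition addd x y := Dual (primal x + primal y) (dualp x + dualp y).
Definition oppd x := Dual (- primal x) (- dualp x).
Definition muld x y :=
  Dual (primal x * primal y) (primal x * dualp y + dualp x * primal y).

Fact adddA : associative addd.
Proof. by move=> [??] [??] [??]; rewrite /addd /= !addrA. Qed.
Fact adddC : commutative addd.
Proof. by move=> [??] [??]; congr Dual; rewrite addrC. Qed.
Fact add0d : left_id (Dual 0 0) addd.
Proof. by move=> [??]; rewrite /addd /= !add0r. Qed.
Fact addNd : left_inverse (Dual 0 0) oppd addd.
Proof. by move=> [??]; rewrite /addd /oppd /= !addNr. Qed.
HB.instance Definition _ :=
  GRing.isZmodule.Build (dual A) adddA adddC add0d addNd.

Fact muldA : associative muld.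
Proof.
by move=> [??] [??] [??]; rewrite /muld /= !mulrDr !mulrDl !mulrA addrA.
Qed.
Fact mul1d : left_id (Dual 1 0) muld.
Proof. by move=> [??]; rewrite /muld /= !mul1r mul0r addr0. Qed.
Fact muld1 : right_id (Dual 1 0) muld.
Proof. by move=> [??]; rewrite /muld /= !mulr1 mulr0 add0r. Qed.
Fact muldDl : left_distributive muld addd.
Proof. by move=> [??] [??] [??]; rewrite /muld /addd /= !mulrDl addrACA. Qed.
Fact muldDr : right_distributive muld addd.
Proof. by move=> [??] [??] [??]; rewrite /muld /addd /= !mulrDr addrACA. Qed.
Fact oned_neq0 : Dual 1 0 != 0 :> dual A.
Proof. by apply/eqP => -[] /eqP; rewrite oner_eq0. Qed.
HB.instance Definition _ :=
  GRing.Zmodule_isNzRing.Build (dual A) muldA mul1d muld1 muldDl muldDr oned_neq0.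

Definition eps : dual A := Dual 0 1.
Definition to_dual (a : A) : dual A := Dual a 0.

End DualRing.

Arguments eps {A}.

Section DualAlgebra.
Variables (R : comNzRingType) (A : algType R).
Implicit Types x y : dual A.

Definition scaled (a : R) x := Dual (a *: primal x) (a *: dualp x).

Fact scaledA a b x : scaled a (scaled b x) = scaled (a * b) x.
Proof. by case: x => *; congr Dual => /=; rewrite scalerA. Qed.
Fact scale1d : left_id 1 scaled.
Proof. by case=> *; congr Dual => /=; rewrite scale1r. Qed.
Fact scaledDr : right_distributive scaled +%R.
Proof. by move=> a [??] [??]; congr Dual => /=; rewrite scalerDr. Qed.
Fact scaledDl x : {morph scaled^~ x : a b / a + b}.
Proof. by case: x => ?? a b; congr Dual => /=; rewrite scalerDl. Qed.
HB.instance Definition _ :=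
  GRing.Zmodule_isLmodule.Build R (dual A) scaledA scale1d scaledDr scaledDl.

Fact scaledAl a x y : a *: (x * y) = (a *: x) * y.
Proof.
by case: x => ??; case: y => ??; congr Dual => /=; rewrite ?scalerDr !scalerAl.
Qed.
HB.instance Definition _ := GRing.Lmodule_isLalgebra.Build R (dual A) scaledAl.
Fact scaledAr a x y : a *: (x * y) = x * (a *: y).
Proof.
by case: x => ??; case: y => ??; congr Dual => /=; rewrite ?scalerDr !scalerAr.
Qed.
HB.instance Definition _ := GRing.Lalgebra_isAlgebra.Build R (dual A) scaledAr.

End DualAlgebra.

Notation dquat R := (dual (quat R)).

(* The conjugation of dual quaternions fixes eps. *)
Definition conjd (R : comNzRingType) (x : dquat R) : dquat R :=
  Dual (conjq (primal x)) (conjq (dualp x)).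

(* In {poly A} the indeterminate commutes with the coefficients, whether or
   not A is commutative. *)
Definition conjpq (R : comNzRingType) (P : {poly quat R}) : {poly quat R} :=
  map_poly (@conjq R) P.
Definition conjpd (R : comNzRingType) (M : {poly dquat R}) : {poly dquat R} :=
  map_poly (@conjd R) M.

Definition primal_part (R : comNzRingType) (M : {poly dquat R}) :
  {poly quat R} := map_poly (@primal (quat R)) M.

Definition dual_poly (R : comNzRingType) (P D : {poly quat R}) :
    {poly dquat R} :=
  map_poly (@to_dual (quat R)) P
    + eps%:P * map_poly (@to_dual (quat R)) D.

(* Real polynomials seen in A[t], for an R-algebra A (here H or DH). *)
Definition rpoly (R : comNzRingType) (A : algType R) (F : {poly R}) :
  {poly A} := map_poly (in_alg A) F.
Arguments rpoly {R A} F.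

Section RealDivisors.
Variables (R : fieldType) (A : algType R).
Implicit Types (F G : {poly R}) (M : {poly A}).

Definition rdvd F M : Prop := exists M', M = rpoly F * M'.

(* Greatest (for divisibility) real polynomial divisor of the family s. *)
Definition is_grpd (s : seq {poly A}) G : Prop :=
  [/\ G \is monic,
      forall M, M \in s -> rdvd G M
    & forall F, (forall M, M \in s -> rdvd F M) -> F %| G].

Lemma rpolyM : {morph @rpoly R A : F G / F * G}.
Proof. exact: rmorphM. Qed.

Lemma rpolyMC F M : rpoly F * M = M * rpoly F.
Proof.
apply/polyP => n; rewrite coefM coefMr; apply: eq_bigr => i _.
by rewrite !coef_map /= mulr_algl mulr_algr.
Qed.

Lemma size_rpolyM F M : F != 0 -> M != 0 ->
  size (rpoly F * M) = (size F + size M).-1.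
Proof.
move=> F0 M0; have lF : lead_coef (rpoly F : {poly A}) = (lead_coef F)%:A.
  by rewrite lead_coef_map.
rewrite size_proper_mul ?size_map_poly // lF mulr_algl.
by rewrite scaler_eq0 negb_or !lead_coef_eq0 F0.
Qed.

Lemma rpolyI F M M' : F != 0 -> rpoly F * M = rpoly F * M' -> M = M'.
Proof.
move=> F0 /eqP; rewrite -subr_eq0 -mulrBr => /eqP E.
apply/eqP; rewrite -subr_eq0; apply/negP => /negP N.
have := size_rpolyM F0 N; rewrite E size_poly0.
move: N F0; rewrite -!size_poly_gt0.
by case: (size F) => // a; case: (size _) => // b; rewrite addnS.
Qed.

Lemma rdvd_size F M : M != 0 -> rdvd F M -> F != 0 /\ (size F <= size M)%N.
Proof.
move=> M0 [M' E].
have F0 : F != 0.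
  by apply: contraNneq M0 => F0; rewrite E F0 /rpoly map_poly0 mul0r.
have M'0 : M' != 0 by apply: contraNneq M0 => M'0; rewrite E M'0 mulr0.
split=> //; rewrite E size_rpolyM //; move: M'0; rewrite -size_poly_gt0.
by case: (size M') => // b _; rewrite addnS leq_addr.
Qed.

Lemma rdvd_lcm F G M : F != 0 -> rdvd F M -> rdvd G M ->
  rdvd (F * (G %/ gcdp F G)) M.
Proof.
move=> F0 [M1 E1] [M2 E2].
set d := gcdp F G; set f := F %/ d; set k := G %/ d.
have d0 : d != 0 by rewrite gcdp_eq0 negb_and F0.
have Ff : F = d * f by rewrite mulrC divpK ?dvdp_gcdl.
have Gk : G = d * k by rewrite mulrC divpK ?dvdp_gcdr.
have /Bezout_eq1_coprimepP[[u v] /= uv] : coprimep f k.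
  by apply: coprimep_div_gcd; rewrite F0.
have fk : rpoly f * M1 = rpoly k * M2.
  by apply: (rpolyI d0); rewrite !mulrA -!rpolyM -Ff -Gk -E1 -E2.
exists (rpoly u * M2 + rpoly v * M1); rewrite E1 rpolyM -mulrA; congr (_ * _).
rewrite -[LHS]mul1r -[1 in LHS](rmorph1 (map_poly (in_alg A))) -uv rmorphD /=.
rewrite -/(rpoly (u * f)) -/(rpoly (v * k)) mulrDl mulrDr !rpolyM.
by rewrite -mulrA fk !mulrA -!rpolyM [u * k]mulrC [v * k]mulrC.
Qed.

Lemma is_grpd_unique s G G' : is_grpd s G -> is_grpd s G' -> G = G'.
Proof.
move=> [mG dG gG] [mG' dG' gG']; apply/eqP.
by rewrite -eqp_monic // /eqp gG' // gG.
Qed.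

Lemma is_grpd_exists s M : M \in s -> M != 0 -> exists G, is_grpd s G.
Proof.
move=> sM M0; pose cd F := forall M', M' \in s -> rdvd F M'.
pose P n := `[< exists2 F, cd F & size F = n >].
have exP : exists n, P n.
  exists (size (1 : {poly R})); apply/asboolP; exists 1 => // M' _.
  by exists M'; rewrite /rpoly rmorph1 mul1r.
have ubP n : P n -> (n <= size M)%N.
  by move=> /asboolP[F cF <-]; have [] := rdvd_size M0 (cF _ sM).
case: (ex_maxnP exP ubP) => _ /asboolP[F cF <-] maxF.
have [F0 _] := rdvd_size M0 (cF _ sM).
have l0 : lead_coef F != 0 by rewrite lead_coef_eq0.
exists ((lead_coef F)^-1 *: F); split.
- by rewrite monicE lead_coefZ mulVf.
- move=> M' /cF[N ->]; exists (rpoly (lead_coef F)%:P * N).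
  rewrite mulrA -rpolyM mulrC mul_polyC scalerA divff // scale1r //.
move=> F' cF'; rewrite dvdpZr ?invr_eq0 //.
have [F'0 _] := rdvd_size M0 (cF' _ sM).
set L := F * (F' %/ gcdp F F').
have cL : cd L by move=> M' sM'; apply: rdvd_lcm; auto.
have FL : F %| L by apply: dvdp_mulr.
have L0 : L != 0 by have [] := rdvd_size M0 (cL _ sM).
have eqFL : F %= L.
  rewrite -dvdp_size_eqp // eqn_leq dvdp_leq //= maxF //.
  by apply/asboolP; exists L.
rewrite (eqp_dvdr _ eqFL) /L mulrC divp_mulAC ?dvdp_gcdr //.
by rewrite -divp_mulA ?dvdp_gcdl // dvdp_mulr.
Qed.

Definition mrpf M : {poly R} :=
  if M == 0 then 1 else xget 1 [set G | is_grpd [:: M] G]%classic.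

Lemma mrpfP M : M != 0 -> is_grpd [:: M] (mrpf M).
Proof.
move=> M0; have [G isG] := is_grpd_exists (mem_head M [::]) M0.
by rewrite /mrpf (negPf M0); apply: (xgetPex 1); exists G.
Qed.

Definition reduced M : Prop := mrpf M = 1.

End RealDivisors.

Section MotionPolynomials.
Variable R : realType.
Implicit Type M : {poly dquat R}.

Definition motion_poly M : Prop :=
  exists N : {poly R}, N != 0 /\ M * conjpd M = rpoly N.

Definition bounded M : Prop :=
  [/\ M \is monic, reduced M, motion_poly M
    & forall x : R, ~~ root (mrpf (primal_part M)) x].

End MotionPolynomials.

(* Main.v *)
Require Import Defs.
From mathcomp Require Import all_boot all_order all_algebra.
From mathcomp Require Import boolp reals.
From mathcomp Require Import ring lra zify complex.
Set Implicit Arguments.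
Unset Strict Implicit.
Unset Printing Implicit Defensive.
Import GRing.Theory.
Local Open Scope ring_scope.

(** Write N(x) = x conj x and tr(x) = x + conj x. Quaternion polynomials are
    treated as quaternions over the commutative ring R[t], where divisibility
    by a real polynomial is divisibility of the four coordinates, and M = c Q
    + eps D as a pair (c Q, D). A linear factor is X - eps d, with X = t - p
    and tr (X conj d) = 0; its norm F = N(X) is quadratic and, as neither c
    nor N(Q) has a real zero, irreducible.

    The divisor g enters through one lemma: for Q without real factors, g
    divides both conj Q D and D conj Q exactly if D = k Q modulo g for a real
    polynomial k such that g divides k N(Q) (dvdq_two_sided,
    real_multiple_two_sided). It rests on the identity x w x = tr(w x) x -
    N(x) conj w, which also shows that X behaves modulo F as a matrix of rank
    one: if F divides Y X Z, it divides Y X or X Z (irred_rank1). The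
    condition is used in the form: c g divides N(D) for every common divisor g
    of c, conj Q D and D conj Q (norm_condition).

    Necessity is an induction on the number of factors. Let M = M' (X - eps
    d). If the real factor of the primal part of M' is c / F, then D conj Q is
    not divisible by F, so all common divisors are coprime to F
    (norm_condition_mulF). Otherwise Q = Q1 X, and D' = k Q1 modulo g or g / F
    (norm_condition_mul). In both cases the condition for M' yields that for
    M.

    Sufficiency is an induction on the degree of c^2 N(Q): a linear factor is
    split off on the right, or on the left by conjugation, so that the
    condition persists (one_sided_step). Let F be an irreducible factor of c.
    If F does not divide D conj Q, then D = Y X with N(X) = F, and X itself is
    a right factor whose cofactor has c / F instead of c
    (right_step_removable), and similarly on the left for conj Q D. If F
    divides both conj Q D and D conj Q, then Q = Q1 X with N(X) = F, every X -
    eps d is a right factor, and both N(D) and the greatest common divisor g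
    have to lose a factor F. The norm does so for all d, and g does for a
    suitable d unless F g divides c and D conj Q (right_step_shift); then it
    does on the left. Once c is constant, Q = Q1 X for any quadratic F
    dividing N(Q), and the dual part d is determined by D (right_step_const). *)

(** * Conjugation, norm and trace *)

Section QuatTheory.
Variable A : comNzRingType.
Implicit Types (a b : A) (x y w d : quat A).

Definition qnorm x : A := q0 x ^+ 2 + q1 x ^+ 2 + q2 x ^+ 2 + q3 x ^+ 2.
Definition trq x : A := q0 x *+ 2.

Lemma quatE x y :
  q0 x = q0 y -> q1 x = q1 y -> q2 x = q2 y -> q3 x = q3 y -> x = y.
Proof. by case: x y => [????] [????] /= -> -> -> ->. Qed.

Lemma quatZE a x : a *: x = Quat (a * q0 x) (a * q1 x) (a * q2 x) (a * q3 x).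
Proof. by []. Qed.

Lemma quatDE x y :
  x + y = Quat (q0 x + q0 y) (q1 x + q1 y) (q2 x + q2 y) (q3 x + q3 y).
Proof. by []. Qed.

Lemma quatNE x : - x = Quat (- q0 x) (- q1 x) (- q2 x) (- q3 x).
Proof. by []. Qed.

Lemma quatME x y : x * y = Defs.mulq x y. Proof. by []. Qed.

Lemma quat1E : 1 = Quat 1 0 0 0 :> quat A. Proof. by []. Qed.
Lemma quat0E : 0 = Quat 0 0 0 0 :> quat A. Proof. by []. Qed.

Ltac quat_ring :=
  rewrite ?quat1E ?quat0E ?(quatME, quatZE, quatDE, quatNE);
  rewrite /trq /qnorm /Defs.mulq /conjq; apply: quatE => /=; ring.

Lemma conjqK : involutive (@conjq A).
Proof. by case=> *; rewrite /conjq /= !opprK. Qed.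
Lemma conjqM x y : conjq (x * y) = conjq y * conjq x.
Proof. quat_ring. Qed.
Lemma conjqD x y : conjq (x + y) = conjq x + conjq y.
Proof. quat_ring. Qed.
Lemma conjqN x : conjq (- x) = - conjq x.
Proof. quat_ring. Qed.
Lemma conjqZ a x : conjq (a *: x) = a *: conjq x.
Proof. quat_ring. Qed.
Lemma conjq1 : conjq 1 = 1 :> quat A.
Proof. quat_ring. Qed.

Lemma mulq_conjr x : x * conjq x = (qnorm x)%:A.
Proof. quat_ring. Qed.
Lemma mulq_conjl x : conjq x * x = (qnorm x)%:A.
Proof. quat_ring. Qed.
Lemma qnormM x y : qnorm (x * y) = qnorm x * qnorm y.
Proof. by rewrite quatME /qnorm /Defs.mulq /=; ring. Qed.
Lemma qnormZ a x : qnorm (a *: x) = a ^+ 2 * qnorm x.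
Proof. by rewrite quatZE /qnorm /=; ring. Qed.
Lemma qnorm_conj x : qnorm (conjq x) = qnorm x.
Proof. by rewrite /qnorm /=; ring. Qed.
Lemma qnormD x y : qnorm (x + y) = qnorm x + trq (x * conjq y) + qnorm y.
Proof. by rewrite quatDE quatME /qnorm /trq /Defs.mulq /=; ring. Qed.

Lemma add_conjq x : x + conjq x = (trq x)%:A.
Proof. quat_ring. Qed.
Lemma trqC x y : trq (x * y) = trq (y * x).
Proof. by rewrite !quatME /trq /Defs.mulq /=; ring. Qed.
Lemma trq_conj x : trq (conjq x) = trq x.
Proof. by []. Qed.
Lemma trqD x y : trq (x + y) = trq x + trq y.
Proof. by rewrite quatDE /trq mulrnDl. Qed.
Lemma trqN x : trq (- x) = - trq x.
Proof. by rewrite quatNE /trq mulNrn. Qed.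
Lemma trqZ a x : trq (a *: x) = a * trq x.
Proof. by rewrite quatZE /trq mulrnAr. Qed.

(** The Cayley-Hamilton theorem for w x, with one factor w cancelled on the
    left. *)
Lemma quat_sandwich x w : x * w * x = trq (w * x) *: x - qnorm x *: conjq w.
Proof. quat_ring. Qed.

Lemma trq_conj_sandwich x w : trq (x * w * conjq x) = qnorm x * trq w.
Proof. by rewrite !quatME /trq /qnorm /Defs.mulq /=; ring. Qed.

Lemma conjq_commute x d :
  conjq x * d - d * x = (trq (x * conjq d))%:A - trq d *: x.
Proof. quat_ring. Qed.

End QuatTheory.

(** * Divisibility of quaternion polynomials by real polynomials *)

Section RealDivisibility.
Variable R : realFieldType.
Implicit Types (a F G k : {poly R}) (x y : quat {poly R}).
Implicit Types (Q D U W X Y Z : quat {poly R}).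

Definition dvdq G Y : Prop := exists Y', Y = G *: Y'.

Lemma dvdqP G Y :
  dvdq G Y <-> [/\ G %| q0 Y, G %| q1 Y, G %| q2 Y & G %| q3 Y].
Proof.
split=> [[Y' ->]|[/dvdpP[a ea] /dvdpP[b eb] /dvdpP[c ec] /dvdpP[d ed]]].
  by split; apply: dvdp_mulr.
exists (Quat a b c d); apply: quatE => /=; by rewrite mulrC.
Qed.

Lemma dvdqD G x y : dvdq G x -> dvdq G y -> dvdq G (x + y).
Proof. by move=> [a ->] [b ->]; exists (a + b); rewrite scalerDr. Qed.
Lemma dvdqN G x : dvdq G x -> dvdq G (- x).
Proof. by move=> [a ->]; exists (- a); rewrite scalerN. Qed.
Lemma dvdqB G x y : dvdq G x -> dvdq G y -> dvdq G (x - y).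
Proof. by move=> dx dy; apply: dvdqD => //; apply: dvdqN. Qed.
Lemma dvdqMl G x y : dvdq G y -> dvdq G (x * y).
Proof. by move=> [a ->]; exists (x * a); rewrite scalerAr. Qed.
Lemma dvdqMr G x y : dvdq G x -> dvdq G (x * y).
Proof. by move=> [a ->]; exists (a * y); rewrite scalerAl. Qed.
Lemma dvdq_conj G x : dvdq G x -> dvdq G (conjq x).
Proof. by move=> [a ->]; exists (conjq a); rewrite conjqZ. Qed.
Lemma dvdq_tr G x : dvdq G x -> G %| trq x.
Proof. by move=> [a ->]; rewrite trqZ dvdp_mulr. Qed.
Lemma dvdqZ G a x : G %| a -> dvdq G (a *: x).
Proof.
by move=> /dvdpP[b ->]; exists (b *: x); rewrite mulrC scalerA.
Qed.
Lemma dvdq_trans F G x : F %| G -> dvdq G x -> dvdq F x.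
Proof. by move=> FG [y ->]; apply: dvdqZ. Qed.
Lemma dvdq_sub G x y : dvdq G (x - y) -> dvdq G x <-> dvdq G y.
Proof.
move=> d; split=> h; last by rewrite -(subrK y x); apply: dvdqD.
by rewrite -(subKr x y); apply: dvdqB.
Qed.

Lemma quatZI a x y : a != 0 -> a *: x = a *: y -> x = y.
Proof.
move=> a0; rewrite !quatZE => -[e0 e1 e2 e3].
by apply: quatE; apply: (mulfI a0).
Qed.

Lemma dvdq_pmul2l a G x : a != 0 -> dvdq (a * G) (a *: x) -> dvdq G x.
Proof.
move=> a0 [y e]; exists y; apply: (quatZI a0); rewrite e scalerA //.
Qed.

Lemma dvdq_Gauss G a x : coprimep G a -> dvdq G (a *: x) -> dvdq G x.
Proof.
by move=> co /dvdqP /=; rewrite !Gauss_dvdpr // => h; apply/dvdqP.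
Qed.

Definition content Y : {poly R} :=
  gcdp (gcdp (q0 Y) (q1 Y)) (gcdp (q2 Y) (q3 Y)).

Lemma dvdq_content G Y : dvdq G Y <-> G %| content Y.
Proof.
rewrite dvdqP /content !dvdp_gcd; split=> [[-> -> -> ->] //|].
by move=> /andP[/andP[? ?] /andP[? ?]].
Qed.

(** Bezout for the four coordinates of Y, whose coefficients are the
    coordinates of the conjugate of 2 U. *)
Lemma content_bezout Y : exists U, trq (U * Y) %= content Y.
Proof.
have [[u0 u1] /= e0] := Bezoutp (q0 Y) (q1 Y).
have [[u2 u3] /= e2] := Bezoutp (q2 Y) (q3 Y).
set a := u0 * _ + _ in e0; set b := u2 * _ + _ in e2.
have [[u v] /= e] := Bezoutp a b.
pose h : {poly R} := (2%:R^-1)%:P.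
exists (h *: Quat (u * u0) (- (u * u1)) (- (v * u2)) (- (v * u3))).
have h2 : h * 2%:R = 1.
  by rewrite /h -polyC_natr -polyCM mulVf // Num.Theory.pnatr_eq0.
rewrite [X in X %= _](_ : _ = u * a + v * b).
  by apply: eqp_trans e _; apply: eqp_gcd.
rewrite -scalerAl trqZ quatME /trq /Defs.mulq /= /a /b.
by rewrite -mulr_natl mulrA h2; ring.
Qed.

Definition primitiveq Q : Prop := forall G, dvdq G Q -> G %| 1.

Lemma primitiveq_conj Q : primitiveq Q -> primitiveq (conjq Q).
Proof. by move=> pQ G /dvdq_conj; rewrite conjqK; apply: pQ. Qed.

Lemma primitiveq_mull Q X : primitiveq (Q * X) -> primitiveq Q.
Proof. by move=> pQ G d; apply/pQ/dvdqMr. Qed.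

(** For G = 0 this concerns a primitive Y, and for an irreducible G a nonzero
    Y modulo G. *)
Lemma bezout_mod G Y : (forall F, F %| G -> dvdq F Y -> F %| 1) ->
  exists U v, trq (U * Y) + v * G = 1.
Proof.
move=> h; have [U eU] := content_bezout Y.
have co : coprimep (trq (U * Y)) G.
  rewrite (eqp_coprimepl _ eU); apply/coprimepP => d dY dG.
  by rewrite -size_poly_eq1 -dvdp1; apply: h => //; apply/dvdq_content.
have /Bezout_eq1_coprimepP[[u v] /= e] := co.
by exists (u *: U), v; rewrite -scalerAl trqZ.
Qed.

Lemma primitiveq_unimod Q : primitiveq Q -> exists U, trq (U * Q) = 1.
Proof.
move=> pQ; have [|U [v e]] := @bezout_mod 0 Q; first by move=> F _ /pQ.
by exists U; rewrite -e mulr0 addr0.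
Qed.

Lemma primitiveq_dvdZ Q G a : primitiveq Q -> dvdq G (a *: Q) -> G %| a.
Proof.
move=> /primitiveq_unimod[U e] d.
by move: (dvdq_tr (dvdqMl U d)); rewrite -scalerAr trqZ e mulr1.
Qed.

Lemma irred_bezout F Y : irreducible_poly F -> ~ dvdq F Y ->
  exists U v, trq (U * Y) + v * F = 1.
Proof.
move=> irrF nFY; apply: bezout_mod => G GF GY.
case: (eqVneq (size G) 1%N) => [/eqP|sG].
  by rewrite size_poly_eq1 => /andP[].
case: nFY; apply: dvdq_trans GY.
by have := irrF.2 _ sG GF; rewrite /eqp => /andP[].
Qed.

(** Modulo F the quaternion X is a matrix of rank one: tr (U Y X) = 1 for some
    U, so that the sandwich identity reads X = X (U Y) X, and X Z is the
    multiple X U (Y X Z) of zero. *)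
Lemma irred_rank1 F X Y Z : irreducible_poly F -> F %| qnorm X ->
  ~ dvdq F (Y * X) -> dvdq F (Y * X * Z) -> dvdq F (X * Z).
Proof.
move=> irrF FX /(irred_bezout irrF)[U [v e]] d.
have -> : X * Z = X * U * (Y * X * Z) + (v * F) *: (X * Z)
                  + qnorm X *: (conjq (U * Y) * Z).
  have -> : X * U * (Y * X * Z) = X * (U * Y) * X * Z by rewrite !mulrA.
  rewrite quat_sandwich -mulrA -[trq _](addrK (v * F)) e.
  by rewrite mulrBl scalerBl scale1r mulrBl !scalerAl addrAC !subrK.
by apply: dvdqD; [apply: dvdqD; [exact: dvdqMl|]|]; apply: dvdqZ => //;
  exact: dvdp_mull.
Qed.

Definition real_multiple_mod g Q D k := dvdq g (D - k *: Q) /\ g %| k * qnorm Q.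

(** The common real divisors of conj Q D and D conj Q are the moduli for which
    D is a real multiple k Q that conj Q annihilates. Indeed, when tr (U Q) =
    1, both divisibilities give D = D U Q = Q U D, hence D = Q W Q with W = U
    D U; by the sandwich identity this is tr (W Q) Q, as N(Q) D = 0. *)
Lemma dvdq_two_sided g Q D : primitiveq Q ->
  dvdq g (conjq Q * D) -> dvdq g (D * conjq Q) ->
  exists k, real_multiple_mod g Q D k.
Proof.
move=> /primitiveq_unimod[U e] dl dr.
pose W := U * D * U; set k := trq (W * Q).
have eU : U * Q = 1 - conjq Q * conjq U.
  by rewrite -conjqM -[1 in RHS]scale1r -e -add_conjq addrK.
have eU' : Q * U = 1 - conjq U * conjq Q.
  by rewrite -conjqM -[1 in RHS]scale1r -e trqC -add_conjq addrK.
have dDk : dvdq g (D - k *: Q).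
  have -> : D - k *: Q = conjq U * (conjq Q * D)
      + Q * U * (D * conjq Q) * conjq U
      - conjq U * conjq (Q * (conjq Q * D)) * conjq U.
    have -> : k *: Q = Q * W * Q + qnorm Q *: conjq W.
      by rewrite quat_sandwich subrK.
    have -> : qnorm Q *: conjq W = conjq U * conjq (Q * (conjq Q * D)) * conjq U.
      rewrite mulrA mulq_conjr -scalerAl mul1r conjqZ /W !conjqM.
      by rewrite -scalerAr -scalerAl mulrA.
    rewrite opprD addrA; congr (_ - _).
    have -> : Q * W * Q = Q * U * (D * (U * Q)) by rewrite /W !mulrA.
    have eD : Q * U * D = D - conjq U * (conjq Q * D).
      by rewrite eU' mulrBl mul1r mulrA.
    rewrite eU mulrBr mulr1 mulrBr eD opprD opprK opprB addrA [D + _]addrC subrK.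
    by rewrite !mulrA.
  apply: dvdqB; last by apply/dvdqMr/dvdqMl/dvdq_conj/dvdqMl.
  by apply: dvdqD; [apply: dvdqMl|apply/dvdqMr/dvdqMl].
exists k; split=> //.
have h : dvdq g (D * conjq Q - k *: (Q * conjq Q)).
  by rewrite scalerAl -mulrBl; apply: dvdqMr.
have /(dvdq_sub h) := dr.
by rewrite mulq_conjr scalerA => /dvdqP[/=]; rewrite mulr1.
Qed.

Lemma real_multiple_two_sided g Q D k : real_multiple_mod g Q D k ->
  dvdq g (conjq Q * D) /\ dvdq g (D * conjq Q).
Proof.
move=> [d gN]; split.
  have h : dvdq g (conjq Q * D - conjq Q * (k *: Q)).
    by rewrite -mulrBr; apply: dvdqMl.
  by apply/(dvdq_sub h); rewrite -scalerAr mulq_conjl scalerA; apply: dvdqZ.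
have h : dvdq g (D * conjq Q - k *: Q * conjq Q).
  by rewrite -mulrBl; apply: dvdqMr.
by apply/(dvdq_sub h); rewrite -scalerAl mulq_conjr scalerA; apply: dvdqZ.
Qed.

End RealDivisibility.

(** * Linear factors and real quadratic polynomials *)

Section Quadratics.
Variable R : rcfType.
Implicit Types (F G : {poly R}) (p d : quat R) (Y : quat {poly R}).

Import Num.Theory Order.TTheory.

Lemma size_quadratic (a b : R) : size (('X - a%:P) ^+ 2 + b%:P) = 3%N.
Proof.
by rewrite size_polyDl size_exp_XsubC // ltnS (leq_trans (size_polyC_leq1 _)).
Qed.

Lemma monic_quadratic (a b : R) : ('X - a%:P) ^+ 2 + b%:P \is monic.
Proof.
rewrite monicE lead_coefDl; first by rewrite -monicE monic_exp ?monicXsubC.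
by rewrite size_exp_XsubC ltnS (leq_trans (size_polyC_leq1 _)).
Qed.

Lemma irred_quadratic (a b : R) : 0 < b ->
  irreducible_poly (('X - a%:P) ^+ 2 + b%:P).
Proof.
move=> b0; apply: cubic_irreducible; first by rewrite size_quadratic.
move=> x; rewrite /root !hornerE gt_eqF //.
by rewrite ltr_wpDl ?sqr_ge0.
Qed.

Definition noroot G : Prop := forall x, ~~ root G x.

Lemma noroot_neq0 G : noroot G -> G != 0.
Proof. by move/(_ 0); apply: contraNneq => ->; apply: root0. Qed.

Lemma noroot_dvd F G : noroot G -> F %| G -> noroot F.
Proof.
by move=> nG /dvdpP[H e] x; apply: contra (nG x) => r; rewrite e rootM r orbT.
Qed.

(** Divide out the real quadratic polynomial of a complex root. *)
Lemma noroot_quadratic G : noroot G -> (1 < size G)%N ->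
  exists F, [/\ F \is monic, size F = 3%N, irreducible_poly F & F %| G].
Proof.
move=> nG sG; pose f := @real_complex R.
have /closed_rootP[[a b] rz] : size (map_poly f G) != 1%N.
  by rewrite size_map_poly gtn_eqF.
have b0 : b != 0.
  apply/eqP => b0; move: rz; rewrite b0 -/(f a) fmorph_root.
  exact/negP.
pose F := ('X - a%:P) ^+ 2 + (b ^+ 2)%:P.
have irrF : irreducible_poly F.
  by apply: irred_quadratic; rewrite exprn_even_gt0.
exists F; split=> //; first exact: monic_quadratic; first exact: size_quadratic.
case: (boolP (F %| G)) => // nFG.
have /Bezout_eq1_coprimepP[[u v] /= e] : coprimep F G.
  by rewrite irreducible_poly_coprime.
have /eqP : (map_poly f (u * F + v * G)).[a +i* b]%C = 1.
  by rewrite e rmorph1 hornerC.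
rewrite rmorphD !rmorphM /= hornerD !hornerM (eqP rz) mulr0 addr0.
rewrite [map_poly f F]rmorphD /= rmorphXn /= rmorphB /= map_polyX !map_polyC /=.
rewrite hornerD horner_exp !hornerE /f /=.
have -> : ((a +i* b)%C - a%:C%C) ^+ 2 + (b ^+ 2)%:C%C = 0.
  rewrite expr2; simpc; apply/eqP; rewrite eq_complex /=.
  by apply/andP; split; apply/eqP; ring.
by rewrite mulr0 eq_sym oner_eq0.
Qed.

Definition cst d : quat {poly R} :=
  Quat (q0 d)%:P (q1 d)%:P (q2 d)%:P (q3 d)%:P.
Definition lin p : quat {poly R} := 'X%:A - cst p.

Lemma linE p :
  lin p = Quat ('X - (q0 p)%:P) (- (q1 p)%:P) (- (q2 p)%:P) (- (q3 p)%:P).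
Proof. by apply: quatE => /=; rewrite ?mulr1 ?mulr0 ?add0r. Qed.

Lemma cstM p d : cst (p * d) = cst p * cst d.
Proof.
by apply: quatE; rewrite quatME /cst /Defs.mulq /= ?(polyCD, polyCB, polyCM, polyCN).
Qed.
Lemma cst_conj p : cst (conjq p) = conjq (cst p).
Proof. by apply: quatE => //=; rewrite polyCN. Qed.
Lemma cstN p : cst (- p) = - cst p.
Proof. by apply: quatE => //=; rewrite polyCN. Qed.
Lemma cst1 : cst 1 = 1.
Proof. by []. Qed.
Lemma cst0 : cst 0 = 0.
Proof. by []. Qed.
Lemma lin_conj p : conjq (lin p) = lin (conjq p).
Proof. by rewrite !linE; apply: quatE => //=; rewrite polyCN. Qed.

Lemma qnorm_cst p : qnorm (cst p) = (qnorm p)%:P.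
Proof. by rewrite /qnorm /= !rmorphD /= !rmorphXn. Qed.

Lemma qnorm_lin p : qnorm (lin p) =
  ('X - (q0 p)%:P) ^+ 2 + (q1 p ^+ 2 + q2 p ^+ 2 + q3 p ^+ 2)%:P.
Proof.
by rewrite linE /qnorm /= !sqrrN !rmorphD /= !rmorphXn /= !addrA.
Qed.

Lemma size_qnorm_lin p : size (qnorm (lin p)) = 3%N.
Proof. by rewrite qnorm_lin size_quadratic. Qed.
Lemma monic_qnorm_lin p : qnorm (lin p) \is monic.
Proof. by rewrite qnorm_lin monic_quadratic. Qed.

Lemma qnorm_eq0 p : (qnorm p == 0) = (p == 0).
Proof.
apply/eqP/eqP => [|->]; last by rewrite quat0E /qnorm /=; ring.
move=> e; have [] : [/\ q0 p ^+ 2 <= 0, q1 p ^+ 2 <= 0, q2 p ^+ 2 <= 0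
    & q3 p ^+ 2 <= 0].
  have [[[a b] c] d] :=
    (sqr_ge0 (q0 p), sqr_ge0 (q1 p), sqr_ge0 (q2 p), sqr_ge0 (q3 p)).
  by move: e; rewrite /qnorm => e; split; lra.
have z x : x ^+ 2 <= 0 -> x = 0 :> R.
  by move=> h; apply/eqP; rewrite -sqrf_eq0 eq_le h sqr_ge0.
by move=> /z ? /z ? /z ? /z ?; apply: quatE.
Qed.

Lemma quat_inv p : p != 0 -> exists p', p * p' = 1 /\ p' * p = 1.
Proof.
rewrite -qnorm_eq0 => p0; exists ((qnorm p)^-1 *: conjq p).
by rewrite -scalerAr -scalerAl mulq_conjr mulq_conjl scalerA mulVf // scale1r.
Qed.

Lemma quat_divmod F Y : size F = 3%N ->
  exists K a b, Y = F *: K + 'X *: cst a + cst b.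
Proof.
move=> sF; have F0 : F != 0 by rewrite -size_poly_gt0 sF.
have lin2 (r : {poly R}) : (size r <= 2)%N -> r = 'X * (r`_1)%:P + (r`_0)%:P.
  move=> sr; apply/polyP => -[|[|n]]; rewrite coefD coefXM !coefC ?add0r ?addr0 //=.
  by rewrite nth_default // (leq_trans sr).
have e (y : {poly R}) :
    y = F * (y %/ F) + 'X * ((y %% F)`_1)%:P + ((y %% F)`_0)%:P.
  have sr : (size (y %% F)%R <= 2)%N by rewrite -ltnS -sF ltn_modp.
  by rewrite -addrA -(lin2 _ sr) mulrC -divp_eq.
exists (Quat (q0 Y %/ F) (q1 Y %/ F) (q2 Y %/ F) (q3 Y %/ F)).
exists (Quat (q0 Y %% F)`_1 (q1 Y %% F)`_1 (q2 Y %% F)`_1 (q3 Y %% F)`_1).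
exists (Quat (q0 Y %% F)`_0 (q1 Y %% F)`_0 (q2 Y %% F)`_0 (q3 Y %% F)`_0).
by apply: quatE => /=; apply: e.
Qed.

Lemma qnorm_mod F (x y : quat {poly R}) :
  dvdq F (x - y) -> (F %| qnorm x) = (F %| qnorm y).
Proof.
case=> z e; have -> : x = y + F *: z by rewrite -e addrC subrK.
rewrite qnormD qnormZ conjqZ -scalerAr trqZ.
rewrite dvdp_addl; last by rewrite expr2 -mulrA dvdp_mulIl.
by rewrite dvdp_addl // dvdp_mulIl.
Qed.

(** Modulo F the polynomial Y is a t + b, with norm divisible by F. This
    excludes a = 0, as the norm of b is a constant. Then p = - a^-1 b, and the
    norm of t - p equals F since both are monic of degree 2. *)
Lemma split_linear F Y : F \is monic -> size F = 3%N -> F %| qnorm Y ->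
  ~ dvdq F Y -> exists p Y', Y = Y' * lin p /\ qnorm (lin p) = F.
Proof.
move=> mF sF FY nFY; have [K [a [b eY]]] := quat_divmod Y sF.
have [a0|/quat_inv[a' [aa' a'a]]] := eqVneq a 0.
  case: nFY; rewrite eY a0 cst0 scaler0 addr0.
  suff -> : b = 0 by rewrite cst0 addr0; exists K.
  apply/eqP; rewrite -qnorm_eq0 -polyC_eq0 -qnorm_cst.
  have dF : F %| qnorm (cst b).
    rewrite -(@qnorm_mod F Y) //; exists K.
    by rewrite eY a0 cst0 scaler0 addr0 addrK.
  apply: contraTT (size_polyC_leq1 (qnorm b)) => nb.
  by rewrite -qnorm_cst -ltnNge (leq_trans _ (dvdp_leq nb dF)) ?sF.
pose p := - (a' * b).
have el : 'X *: cst a + cst b = cst a * lin p.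
  rewrite /lin mulrBr -scalerAr mulr1 /p -cstM mulrN mulrA aa' mul1r cstN.
  by rewrite opprK.
have eF : qnorm (lin p) = F.
  apply/eqP; rewrite eq_sym -eqp_monic ?monic_qnorm_lin //.
  rewrite -dvdp_size_eqp ?sF ?size_qnorm_lin //.
  have : F %| qnorm (cst a * lin p).
    rewrite -(@qnorm_mod F Y) //; exists K.
    by rewrite eY -[_ + cst b]addrA el addrK.
  rewrite qnormM qnorm_cst mul_polyC dvdpZr // qnorm_eq0.
  by apply/eqP => a0; move/eqP: a'a; rewrite a0 mulr0 eq_sym oner_eq0.
exists p, (K * conjq (lin p) + cst a); split=> //.
by rewrite mulrDl -el addrA -mulrA mulq_conjl eF -scalerAr mulr1 eY.
Qed.

(** The equation saying that t - p - eps d is a motion polynomial. *)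
Definition motion_lin p d : Prop := trq (lin p * conjq (cst d)) = 0.

Lemma motion_lin_tr p d : motion_lin p d -> trq (cst d) = 0.
Proof.
move=> m; suff d0 : q0 d = 0 by rewrite /trq /= d0 mul0rn.
have /(congr1 (fun P : {poly R} => P`_1)) : ((q0 d) *+ 2) *: 'X
   = (q0 p * q0 d + q1 p * q1 d + q2 p * q2 d + q3 p * q3 d)%:P *+ 2 :> {poly R}.
  apply/eqP; rewrite -subr_eq0 -m /motion_lin linE quatME /trq /Defs.mulq /=.
  by rewrite -mul_polyC !(polyCD, polyCM, polyCN, polyCMn); apply/eqP; ring.
rewrite coefMn coefC mul0rn coefZ coefX mulr1 => /eqP.
by rewrite mulrn_eq0 => /eqP.
Qed.

(** By the motion equation d has no scalar part and is orthogonal to the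
    vector part of p; so d anticommutes with the latter. *)
Lemma motion_lin_commute p d : motion_lin p d ->
  conjq (lin p) * cst d = cst d * lin p.
Proof.
move=> m; apply/eqP; rewrite -subr_eq0 conjq_commute m (motion_lin_tr m).
by rewrite !scale0r subrr.
Qed.

Lemma motion_lin_exists p : exists d, d != 0 /\ motion_lin p d.
Proof.
have [e|ne] := boolP ((q1 p == 0) && (q2 p == 0)).
  exists (Quat 0 1 0 0); split; last first.
    case/andP: e => /eqP e1 /eqP e2; rewrite /motion_lin linE e1 e2.
    by rewrite quatME /trq /Defs.mulq /= polyC0; ring.
  by apply/eqP => -[] /eqP; rewrite oner_eq0.
(* the cross product of the vector part of p with k *)
exists (Quat 0 (q2 p) (- q1 p) 0); split.
  apply: contra ne => /eqP[-> /eqP]; rewrite oppr_eq0 => -> //.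
  by rewrite eqxx.
by rewrite /motion_lin linE quatME /trq /Defs.mulq /= polyCN polyC0; ring.
Qed.

End Quadratics.

(** * The divisibility condition and splitting off a linear factor *)

Section NormCondition.
Variable R : realFieldType.
Implicit Types (c F g : {poly R}) (Q D Y X d : quat {poly R}).

Definition common_divisor c Q D g : Prop :=
  [/\ g %| c, dvdq g (conjq Q * D) & dvdq g (D * conjq Q)].

Definition norm_condition c Q D : Prop :=
  forall g, common_divisor c Q D g -> c * g %| qnorm D.

Lemma irred_coprime F g : irreducible_poly F -> ~ F %| g -> coprimep g F.
Proof.
by move=> irrF /negP nFg; rewrite coprimep_sym irreducible_poly_coprime.
Qed.

(** Modulo g the mixed term of the norm is k tr (Q X conj d conj Q), that is k
    N(Q) tr (X conj d). *)
Lemma dvdp_qnorm_motion c g k Q X D d :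
    g %| c -> real_multiple_mod g (Q * X) D k -> trq (X * conjq d) = 0 ->
  (c * g %| qnorm (D + c *: (Q * d))) = (c * g %| qnorm D).
Proof.
move=> gc [gD gk] Xd; rewrite qnormD conjqZ -scalerAr trqZ qnormZ.
rewrite dvdp_addl; last by rewrite expr2 -mulrA dvdp_mul ?dvdp_mulr.
rewrite dvdp_addl // dvdp_mul //.
have -> : D = (D - k *: (Q * X)) + k *: (Q * X) by rewrite subrK.
rewrite mulrDl trqD dvdp_add //; first exact/dvdq_tr/dvdqMr.
rewrite -scalerAl trqZ conjqM -mulrA [X * _]mulrA mulrA.
by rewrite trq_conj_sandwich Xd !mulr0 dvdp0.
Qed.

(** Here X contributes its norm F to the real factor of the primal part. Then
    F does not divide D conj Q = (D conj X / F) X conj Q, as X has rank one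
    and neither D nor X conj Q vanishes modulo F; so every common divisor g of
    the product is coprime to F and is common to the data of the left
    cofactor. *)
Lemma norm_condition_mulF c Q D' X d :
    irreducible_poly (qnorm X) ->
    ~ dvdq (qnorm X) (Q * conjq X) ->
    conjq X * d = d * X ->
    let D := D' * X - c *: (Q * conjq X) * d in
    ~ dvdq (qnorm X) D ->
  norm_condition c (Q * conjq X) D' -> norm_condition (qnorm X * c) Q D.
Proof.
set F := qnorm X => irrF nFQ Xd D nFD nc g [gc gl gr].
have F0 : F != 0 by case: irrF => /ltnW; rewrite size_poly_gt0.
pose Y := D' - c *: (Q * d).
have eD : D = Y * X.
  by rewrite /D /Y mulrBl -!scalerAl -!mulrA Xd.
have nFg : ~ F %| g.
  move=> Fg; apply: nFQ; rewrite -[Q * _]conjqK; apply: dvdq_conj.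
  rewrite conjqM conjqK; apply: (@irred_rank1 _ F X Y) => //; rewrite -?eD //.
  exact: dvdq_trans gr.
have co := irred_coprime irrF nFg.
have gc' : g %| c by move: gc; rewrite Gauss_dvdpr.
have eD' : D' = Y + c *: (Q * d) by rewrite subrK.
have gY : dvdq g (X * conjq Q * Y).
  apply: (dvdq_Gauss co).
  have -> : F *: (X * conjq Q * Y) = X * (conjq Q * D) * conjq X.
    by rewrite eD -!mulrA mulq_conjr -/F -!scalerAr mulr1.
  exact/dvdqMr/dvdqMl.
have : c * g %| qnorm D'.
  apply: nc; split=> //; rewrite conjqM conjqK eD'.
    by rewrite mulrDr; apply: dvdqD => //; rewrite -scalerAr; apply: dvdqZ.
  rewrite mulrDl mulrA -eD; apply: dvdqD => //.
  by rewrite -scalerAl; apply: dvdqZ.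
rewrite eD' qnormD conjqZ -scalerAr trqZ qnormZ.
have gt : g %| trq (Y * conjq (Q * d)).
  rewrite -(Gauss_dvdpr _ co) -/F -trqZ scalerAl.
  have -> : F *: Y = D * conjq X.
    by rewrite eD -mulrA mulq_conjr -/F -scalerAr mulr1.
  by rewrite conjqM mulrA trqC 2!mulrA; apply/dvdq_tr/dvdqMr/dvdqMr.
rewrite dvdp_addl; last by rewrite expr2 -mulrA dvdp_mul ?dvdp_mulr.
rewrite dvdp_addl; last by rewrite dvdp_mul.
by move=> cg; rewrite eD qnormM -/F [qnorm Y * F]mulrC -mulrA dvdp_mul2l.
Qed.

(** Here X is absorbed by Q. For a common divisor g of the product, D' = k Q
    modulo g, or modulo g / F when F = N(X) divides g; the lost F reappears in
    N(D' X) = N(D') F. *)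
Lemma norm_condition_mul c Q D' X d :
    irreducible_poly (qnorm X) ->
    primitiveq (Q * X) ->
    trq (X * conjq d) = 0 ->
  norm_condition c Q D' -> norm_condition c (Q * X) (D' * X - c *: Q * d).
Proof.
set F := qnorm X; set D := D' * X - _ => irrF pQ Xd nc g [gc gl gr].
have F0 : F != 0 by case: irrF => /ltnW; rewrite size_poly_gt0.
have [k [gD gk]] := dvdq_two_sided pQ gl gr.
have eD : D' * X = D + c *: (Q * d) by rewrite /D scalerAl subrK.
have gF : dvdq g (F *: (D' - k *: Q)).
  have -> : F *: (D' - k *: Q) = (D - k *: (Q * X) + c *: (Q * d)) * conjq X.
    rewrite addrAC -eD scalerAl -mulrBl -mulrA mulq_conjr -/F.
    by rewrite -scalerAr mulr1.
  by apply/dvdqMr/dvdqD => //; apply: dvdqZ.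
have FN : c * g %| F * qnorm D'.
  have common h : h %| c -> dvdq h (D' - k *: Q) -> h %| k * qnorm Q ->
      c * h %| qnorm D'.
    move=> hc hD hN; have [hl hr] := real_multiple_two_sided (conj hD hN).
    by apply: nc; split.
  move: gk; rewrite qnormM mulrA -/F => gk.
  have [Fg|nFg] := boolP (F %| g).
    move: gc gF gk; case/dvdpP: Fg => h -> gc gF gk.
    rewrite [h * F]mulrC mulrCA dvdp_mul2l //; apply: common.
    - by apply: dvdp_trans gc; apply: dvdp_mulIl.
    - by apply: (dvdq_pmul2l F0); rewrite mulrC.
    by move: gk; rewrite dvdp_mul2r.
  have co : coprimep g F by apply: irred_coprime => //; apply/negP.
  apply/dvdp_mull/common => //; first exact: dvdq_Gauss gF.
  by move: gk; rewrite Gauss_dvdpl.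
by rewrite -(dvdp_qnorm_motion gc (conj gD gk) Xd) -eD qnormM [qnorm D' * _]mulrC.
Qed.

End NormCondition.

(** * Products of linear factors satisfy the divisibility condition *)

Section Necessity.
Variable R : rcfType.
Implicit Types (c F G : {poly R}) (Q D X : quat {poly R}) (h : dquat R).
Import Num.Theory Order.TTheory.

(** The polynomial t - h, as a pair of quaternion polynomials. *)
Definition dlin h : dquat {poly R} :=
  Dual (lin (primal h)) (- cst (dualp h)).

Definition motion_dlin h : Prop := motion_lin (primal h) (dualp h).

Lemma mulr_dlin (P D : quat {poly R}) h : Dual P D * dlin h =
  Dual (P * lin (primal h)) (D * lin (primal h) - P * cst (dualp h)).
Proof. by congr Dual => /=; rewrite mulrN addrC. Qed.

(** If p were real, then t - p would be a real factor of c Q, hence of c. *)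
Lemma irred_qnorm_lin c Q P p :
  noroot c -> primitiveq Q -> c *: Q = P * lin p ->
  irreducible_poly (qnorm (lin p)).
Proof.
move=> rc pQ e; rewrite qnorm_lin; apply: irred_quadratic.
have v0 : 0 <= q1 p ^+ 2 + q2 p ^+ 2 + q3 p ^+ 2 by rewrite !addr_ge0 ?sqr_ge0.
rewrite lt_neqAle v0 andbT; apply/eqP => v.
have ep : lin p = ('X - (q0 p)%:P)%:A.
  suff -> : p = (q0 p)%:A by apply: quatE; rewrite linE /= ?(mulr1, mulr0, oppr0).
  have : qnorm (p - (q0 p)%:A) == 0.
    rewrite /qnorm /= !mulr0 mulr1 subrr !oppr0 !addr0 expr0n add0r.
    by rewrite -v.
  by rewrite qnorm_eq0 subr_eq0 => /eqP.
have : 'X - (q0 p)%:P %| c.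
  by apply: (primitiveq_dvdZ pQ); rewrite e ep -scalerAr mulr1; exists P.
by rewrite dvdp_XsubCl; apply/negP/rc.
Qed.

Lemma primitiveq_mul_conj Q X : irreducible_poly (qnorm X) -> primitiveq Q ->
  ~ dvdq (qnorm X) (Q * conjq X) -> primitiveq (Q * conjq X).
Proof.
move=> irrF pQ nF G GQ.
have GF : G %| qnorm X.
  apply: (primitiveq_dvdZ pQ); have := dvdqMr X GQ.
  by rewrite -mulrA mulq_conjl -scalerAr mulr1.
have [sG|sG] := eqVneq (size G) 1%N; first by rewrite dvdp1 sG.
case: nF; apply: dvdq_trans GQ.
by have := irrF.2 _ sG GF; rewrite /eqp => /andP[].
Qed.

Lemma irred_ndvd1 F : irreducible_poly F -> ~~ (F %| 1).
Proof. by case=> sF _; rewrite dvdp1 gtn_eqF. Qed.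

Definition coprime_dual c D : Prop := forall G, G %| c -> dvdq G D -> G %| 1.

(** Split off the last factor X of norm F. From c Q = P' X follows F P' = c Q
    conj X; so P' is c times a left factor of Q, unless F divides c but not Q
    conj X. *)
Theorem norm_condition_prod (s : seq (dquat R)) c Q D :
    (forall h, h \in s -> motion_dlin h) ->
    Dual (c *: Q) D = \prod_(h <- s) dlin h ->
    noroot c -> primitiveq Q -> coprime_dual c D ->
  norm_condition c Q D.
Proof.
elim/last_ind: s c Q D => [|s h IH] c Q D ms.
  rewrite big_nil => /(congr1 (@dualp _)) /= -> _ _ _ g _.
  by rewrite -(scale0r 1) qnormZ expr0n mul0r dvdp0.
rewrite big_rcons /=; case eM' : (\prod_(i <- s) dlin i) => [P' D'].
rewrite mulr_dlin; set X := lin _; set d := cst _ => eM rc pQ rD.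
have eP := congr1 (@primal _) eM; have eD := congr1 (@dualp _) eM.
rewrite /= in eP eD.
have mh : motion_dlin h by apply: ms; rewrite mem_rcons mem_head.
have {}IH c' Q' : P' = c' *: Q' -> noroot c' -> primitiveq Q' ->
    coprime_dual c' D' ->
    norm_condition c' Q' D'.
  move=> eP'; apply: IH => [h' h's|].
    by apply: ms; rewrite mem_rcons inE h's orbT.
  by rewrite eM' eP'.
have irrF := irred_qnorm_lin rc pQ eP; rewrite -/X in irrF.
have F0 : qnorm X != 0 by case: irrF => /ltnW; rewrite size_poly_gt0.
have c0 := noroot_neq0 rc.
have caseB Q1 : P' = c *: Q1 -> norm_condition c Q D.
  move=> eP'; have eQ : Q = Q1 * X.
    by apply: (quatZI c0); rewrite eP eP' scalerAl.
  rewrite eQ eD eP'; rewrite eQ in pQ; apply: norm_condition_mul => //.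
  apply: IH => //; first exact: primitiveq_mull pQ.
  move=> G Gc GD; apply: rD => //; rewrite eD eP'; apply: dvdqB.
    exact: dvdqMr.
  by rewrite -scalerAl; apply: dvdqZ.
have eFP : qnorm X *: P' = c *: (Q * conjq X).
  by rewrite scalerAl eP -mulrA mulq_conjr -scalerAr mulr1.
have [Fc|nFc] := boolP (qnorm X %| c); last first.
  have [Q1 eQ1] : dvdq c P'.
    apply: (@dvdq_Gauss _ _ (qnorm X)); last by rewrite eFP; exists (Q * conjq X).
    by apply: irred_coprime => //; apply/negP.
  exact: caseB eQ1.
have [[Q1 eQ1]|nFQ] := pselect (dvdq (qnorm X) (Q * conjq X)).
  by apply: (caseB Q1); apply: (quatZI F0); rewrite eFP eQ1 !scalerA mulrC.
case/dvdpP: (Fc) => c' ec; rewrite mulrC in ec.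
have eP' : P' = c' *: (Q * conjq X).
  by apply: (quatZI F0); rewrite eFP ec scalerA.
rewrite ec eD eP'; apply: norm_condition_mulF => //.
- exact: motion_lin_commute mh.
- by move=> FD; have := irred_ndvd1 irrF; rewrite rD // eD eP'.
apply: IH => //; first by apply: noroot_dvd rc _; rewrite ec dvdp_mulIr.
  exact: primitiveq_mul_conj.
move=> G Gc GD; apply: rD; first by rewrite ec dvdp_mull.
rewrite eD eP'; apply: dvdqB; first exact: dvdqMr.
by rewrite -scalerAl; apply: dvdqZ.
Qed.

End Necessity.

(** * Splitting off linear factors *)

Section Sufficiency.
Variable R : rcfType.
Implicit Types (c F G g : {poly R}) (Q D X : quat {poly R}) (h : dquat R).
Import Num.Theory Order.TTheory.

Definition splittable c Q D : Prop :=
  [/\ noroot c, primitiveq Q, coprime_dual c D, trq (D * conjq Q) = 0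
    & norm_condition c Q D].

Definition right_step c Q D : Prop :=
  exists c' Q' D' h, [/\ motion_dlin h, splittable c' Q' D'
    & Dual (c *: Q) D = Dual (c' *: Q') D' * dlin h].

Lemma motion_lin0 (p : quat R) : motion_lin p 0.
Proof.
by rewrite /motion_lin linE quatME /trq /Defs.mulq /= polyC0; ring.
Qed.

Lemma motion_lin_commuter (p d : quat R) : motion_lin p d ->
  lin p * cst d = cst d * conjq (lin p).
Proof.
move=> m; have := add_conjq (lin p); set x := lin p => e.
have ex : x = (trq x)%:A - conjq x by rewrite -e addrK.
have ec : conjq x = (trq x)%:A - x by rewrite -e addrC addKr.
have : ((trq x)%:A - conjq x) * cst d = cst d * ((trq x)%:A - x).
  by rewrite mulrBl mulrBr motion_lin_commute // -scalerAl -scalerAr mul1r mulr1.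
by rewrite -ec -ex.
Qed.

Lemma trq_split c Q X D d :
    qnorm X != 0 -> trq (X * conjq d) = 0 ->
    trq ((D * X - c *: Q * d) * conjq (Q * X)) = 0 ->
  trq (D * conjq Q) = 0.
Proof.
move=> F0 Xd; rewrite mulrBl trqD trqN conjqM -mulrA [X * _]mulrA mulq_conjr.
rewrite -!scalerAl -scalerAr !trqZ mul1r mulrA -[Q * d * _]mulrA.
rewrite trq_conj_sandwich -[d * _]conjqK trq_conj conjqM conjqK Xd !mulr0 subr0.
by move/eqP; rewrite mulf_eq0 (negPf F0) => /eqP.
Qed.

Lemma coprime_dual_split c Q X D d :
  coprime_dual c (D * X - c *: Q * d) -> coprime_dual c D.
Proof.
move=> rD G Gc GD; apply: rD => //; apply: dvdqB; first exact: dvdqMr.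
by rewrite -scalerAl; apply: dvdqZ.
Qed.

Lemma primitiveq_irred F Q : irreducible_poly F -> primitiveq Q -> ~ dvdq F Q.
Proof. by move=> irrF pQ /pQ; apply/negP/irred_ndvd1. Qed.

(** Since F divides c and thus N(D), the dual part D has a right factor X of
    norm F, and X takes F away from c. As F does not divide D conj Q, the
    quaternion Q conj X stays primitive, and the common divisors for the
    cofactor are among those for Q and D. *)
Lemma right_step_removable c Q D F : splittable c Q D ->
    F \is monic -> size F = 3%N -> irreducible_poly F ->
    F %| c -> ~ dvdq F (D * conjq Q) ->
  right_step c Q D.
Proof.
move=> [rc pQ rD tD nc] mF sF irrF Fc nFD.
have F0 : F != 0 := irredp_neq0 irrF.
have FD : F %| qnorm D.
  apply: dvdp_trans Fc _; rewrite -[c]mulr1; apply: nc.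
  split; first exact: dvd1p.
    by exists (conjq Q * D); rewrite scale1r.
  by exists (D * conjq Q); rewrite scale1r.
have [|p [Y [eD eF]]] := split_linear mF sF FD.
  by move=> h; apply/nFD/dvdqMr.
set X := lin p in eD eF.
have nFQ : ~ dvdq F (Q * conjq X).
  move=> /dvdq_conj; rewrite conjqM conjqK => h; apply: nFD.
  by rewrite eD -mulrA; apply: dvdqMl.
case/dvdpP: (Fc) => c' ec.
exists c', (Q * conjq X), Y, (Dual p 0); split; first exact: motion_lin0.
  split.
  - by apply: noroot_dvd rc _; rewrite ec dvdp_mulIl.
  - by apply: primitiveq_mul_conj; rewrite ?eF.
  - move=> G Gc GY; apply: rD; first by rewrite ec dvdp_mulr.
    by rewrite eD; apply: dvdqMr.
  - by rewrite conjqM conjqK mulrA -eD.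
  move=> g [gc]; rewrite conjqM conjqK mulrA -eD => gl gr.
  have co : coprimep g F.
    by apply: irred_coprime => // Fg; apply: nFD; apply: dvdq_trans gr.
  have : c * g %| qnorm D.
    apply: nc; split=> //; first by rewrite ec dvdp_mulr.
    apply: (dvdq_Gauss co).
    have -> : F *: (conjq Q * D) = conjq X * (X * conjq Q * Y) * X.
      by rewrite eD -eF !mulrA mulq_conjl -!scalerAl mul1r.
    exact/dvdqMr/dvdqMl.
  by rewrite eD qnormM eF ec mulrAC dvdp_mul2r.
rewrite mulr_dlin cst0 mulr0 subr0 -eD; congr Dual.
by rewrite -scalerAl -mulrA mulq_conjl -/X eF -scalerAr mulr1 scalerA ec.
Qed.

(** The choice of the dual part of the next linear factor. If F g does not
    divide c, then c Q d conj (Q X) does not vanish modulo F g: otherwise F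
    would divide (Q d) conj X (conj Q) with X of rank one modulo F. *)
Lemma shift_not_dvdq c Q X F g D p :
    primitiveq (Q * X) -> irreducible_poly F -> g != 0 -> X = lin p ->
    F %| qnorm X ->
    g %| c -> ~ dvdq (F * g) (D * conjq (Q * X)) \/ ~ F * g %| c ->
  exists d, motion_lin p d /\
    ~ dvdq (F * g) ((D + c *: Q * cst d) * conjq (Q * X)).
Proof.
move=> pQ irrF g0 eX FX gc h.
have [h1|h1] := pselect (dvdq (F * g) (D * conjq (Q * X))); last first.
  by exists 0; rewrite cst0 mulr0 addr0; split=> //; apply: motion_lin0.
case: h => // nFg; have [d [d0 md]] := motion_lin_exists p.
exists d; split=> // h2.
have [d' [dd' _]] := quat_inv d0.
have nFQ := primitiveq_irred irrF pQ.
case/dvdpP: (gc) => c2 ec.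
have co : coprimep F c2.
  rewrite irreducible_poly_coprime //; apply/negP => Fc2.
  by apply: nFg; rewrite ec; apply: dvdp_mul.
have : dvdq F (Q * cst d * conjq X * conjq Q).
  apply: (dvdq_Gauss co); apply: (dvdq_pmul2l g0).
  have := dvdqB h2 h1; rewrite mulrDl addrC addKr conjqM.
  by rewrite ec [g * F]mulrC scalerA [g * c2]mulrC -!scalerAl !mulrA.
move/(irred_rank1 irrF); rewrite qnorm_conj => /(_ FX) hh.
apply: nFQ; rewrite -[Q * X]conjqK; apply: dvdq_conj; rewrite conjqM.
apply: hh; rewrite -mulrA eX -(motion_lin_commuter md) -eX mulrA => hd.
apply: (primitiveq_irred irrF pQ).
by have := dvdqMr (cst d') hd; rewrite -mulrA -cstM dd' cst1 mulr1.
Qed.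

(** Here F divides both D conj Q and conj Q D, hence N(Q), and the linear
    factor is split off from Q = Q1 X. The dual part D' of the cofactor has F
    N(D') = N(D + c Q1 d), so its norm loses one factor F; the choice of d
    makes sure that g is not a common divisor for Q1 and D', so that the
    common divisors lose one factor F as well. *)
Lemma right_step_shift c Q D F g : splittable c Q D ->
    F \is monic -> size F = 3%N -> irreducible_poly F ->
    common_divisor c Q D g ->
    (forall g', common_divisor c Q D g' -> g' %| g) -> F %| g ->
    ~ dvdq (F * g) (D * conjq Q) \/ ~ F * g %| c ->
  right_step c Q D.
Proof.
move=> [rc pQ rD tD nc] mF sF irrF cg maxg Fg h.
have F0 : F != 0 := irredp_neq0 irrF.
have [gc gl gr] := cg.
have c0 := noroot_neq0 rc.
have g0 : g != 0 by apply: contraNneq c0 => e; rewrite e dvd0p in gc.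
have [k [[E eE] gk]] := dvdq_two_sided pQ gl gr.
have nFk : ~~ (F %| k).
  apply/negP => Fk; have := irred_ndvd1 irrF; rewrite rD //.
    exact: dvdp_trans gc.
  by rewrite -(subrK (k *: Q) D) eE; apply: dvdqD; apply: dvdqZ.
have FN : F %| qnorm Q.
  rewrite -(@Gauss_dvdpr _ _ k) ?irreducible_poly_coprime //.
  exact: dvdp_trans gk.
have [p [Q1 [eQ eF]]] := split_linear mF sF FN (primitiveq_irred irrF pQ).
set X := lin p in eQ eF; rewrite eQ in pQ.
have FX : F %| qnorm X by rewrite eF.
rewrite eQ in h.
have [d [md nd]] := shift_not_dvdq pQ irrF g0 erefl FX gc h.
set d1 := cst d in nd.
have Xd : trq (X * conjq d1) = 0 := md.
case/dvdpP: (Fg) => g1 eg; case/dvdpP: (gc) => c2 ec.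
pose D' := k *: Q1 + g1 *: ((E + c2 *: (Q1 * d1)) * conjq X).
have eD : D' * X = D + c *: Q1 * d1.
  have -> : D = g *: E + k *: Q by rewrite -eE subrK.
  rewrite /D' mulrDl -!scalerAl -eQ -mulrA mulq_conjl eF -scalerAr mulr1.
  rewrite scalerA -eg scalerDr scalerA mulrC -ec.
  by rewrite addrA [k *: Q + _]addrC.
have eD' : D = D' * X - c *: Q1 * d1 by rewrite eD addrK.
have gQX : real_multiple_mod g (Q1 * X) D k.
  by rewrite -eQ; split=> //; exists E.
exists c, Q1, D', (Dual p d); split=> //; last first.
  by rewrite mulr_dlin /= -/X -/d1 -eD' eQ scalerAl.
split=> //; first exact: primitiveq_mull pQ.
- by apply: (@coprime_dual_split _ Q1 X _ d1); rewrite -eD'.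
- by apply: (@trq_split c _ X _ d1) => //; rewrite ?eF // -eD' -eQ.
move=> g' [gc' gl' gr'].
have [k' [gD' gk']] := dvdq_two_sided (primitiveq_mull pQ) gl' gr'.
have : g' %| g.
  apply: maxg; rewrite eQ.
  suff /real_multiple_two_sided[] : real_multiple_mod g' (Q1 * X) D k' by split.
  split; last by rewrite qnormM mulrA dvdp_mulr.
  rewrite eD' addrAC scalerAl -mulrBl; apply: dvdqB; first exact: dvdqMr.
  by rewrite -scalerAl; apply: dvdqZ.
case/dvdpP => u eu.
have g'0 : g' != 0 by apply: contraNneq g0 => e; rewrite eu e mulr0.
(* otherwise g itself would divide D' conj Q1 *)
have [Fu|nFu] := boolP (F %| u); last first.
  case: nd; rewrite -eD conjqM -mulrA [X * _]mulrA mulq_conjr eF.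
  rewrite -scalerAl mul1r -scalerAr.
  case: gr' => T eT; rewrite eT.
  have co : coprimep u F by rewrite coprimep_sym irreducible_poly_coprime.
  suff [T' ->] : dvdq u T.
    by exists T'; rewrite !scalerA eu; congr (_ *: _); ring.
  apply: (dvdq_Gauss co); apply: (dvdq_pmul2l g'0).
  rewrite scalerA mulrC -eu [g' * F]mulrC -scalerA -eT.
  have -> : F *: (D' * conjq Q1) = D' * X * conjq (Q1 * X).
    by rewrite conjqM -mulrA [X * _]mulrA mulq_conjr eF -scalerAl mul1r -scalerAr.
  rewrite eD mulrDl -eQ; apply: dvdqD => //.
  by apply: dvdqMr; rewrite -scalerAl; apply: dvdqZ.
case/dvdpP: Fu => u' eu'.
have : c * g %| qnorm (D' * X).
  by rewrite eD -scalerAl (dvdp_qnorm_motion gc gQX) // nc.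
rewrite qnormM eF eu eu' mulrA mulrAC [X in X %| _]mulrC.
move=> hh; rewrite -(dvdp_mul2r _ _ F0); apply: dvdp_trans hh.
by apply/dvdpP; exists u'; ring.
Qed.

End Sufficiency.

Section Splitting.
Variable R : rcfType.
Implicit Types (c F G g : {poly R}) (Q D X : quat {poly R}) (h : dquat R).
Import Num.Theory Order.TTheory.

(** A real zero of a sum of four squares is a zero of every term. *)
Lemma noroot_qnorm Q : primitiveq Q -> noroot (qnorm Q).
Proof.
move=> pQ x; apply/negP => rx.
pose v := Quat (q0 Q).[x] (q1 Q).[x] (q2 Q).[x] (q3 Q).[x].
have : qnorm v == 0.
  by move: rx; rewrite /root /qnorm !hornerE.
rewrite qnorm_eq0 => /eqP[/eqP r0 /eqP r1 /eqP r2 /eqP r3].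
have : dvdq ('X - x%:P) Q by apply/dvdqP; rewrite !dvdp_XsubCl.
by move/pQ; apply/negP/irred_ndvd1/irredp_XsubC.
Qed.

Lemma quat_div_lin Y (p : quat R) : exists K r, Y = K * lin p + cst r.
Proof.
have [K [a [b ->]]] := quat_divmod Y (size_qnorm_lin p).
exists (K * conjq (lin p) + cst a), (a * p + b).
rewrite mulrDl -mulrA mulq_conjl -scalerAr mulr1.
rewrite [cst a * _]mulrBr -scalerAr mulr1 -!addrA; congr (_ + (_ + _)).
suff -> : cst (a * p + b) = cst a * cst p + cst b by rewrite addKr.
by rewrite -cstM; apply: quatE; rewrite /= polyCD.
Qed.

Lemma trq_lin_const (p a : quat R) F : (2 < size F)%N ->
  F %| trq (cst a * lin p) -> trq (cst a * lin p) = 0.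
Proof.
move=> sF /dvdp_leq dF; apply/eqP; apply: contraTT sF => n0.
rewrite -leqNgt; apply: leq_trans (dF n0) _.
rewrite /lin mulrBr -cstM -scalerAr mulr1 trqD trqN trqZ.
rewrite /trq /= -!polyCMn -polyCN.
by rewrite mulrC size_MXaddC; case: ifP => // _; rewrite ltnS size_polyC_leq1.
Qed.

(** With a constant c, the dual part of the linear factor is the value needed
    to make D + c Q1 d right divisible by t - p, where Q = Q1 (t - p); it
    satisfies the motion equation because the trace of D conj Q vanishes. *)
Lemma right_step_const c Q D F : splittable c Q D ->
    F \is monic -> size F = 3%N -> irreducible_poly F -> c %| 1 ->
    F %| qnorm Q ->
  right_step c Q D.
Proof.
move=> [rc pQ rD tD nc] mF sF irrF c1 FN.
have F0 : F != 0 := irredp_neq0 irrF.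
have c0 := noroot_neq0 rc.
have [p [Q1 [eQ eF]]] := split_linear mF sF FN (primitiveq_irred irrF pQ).
set X := lin p in eQ eF.
have [K [r eQ1]] := quat_div_lin Q1 (conjq p).
rewrite -lin_conj -/X in eQ1.
have [|r' [rr' r'r]] := @quat_inv _ r.
  apply/eqP => r0; apply: (primitiveq_irred irrF pQ); exists K.
  by rewrite eQ eQ1 r0 cst0 addr0 -mulrA mulq_conjl eF -scalerAr mulr1.
have [D1 [e eD]] := quat_div_lin D p; rewrite -/X in eD.
have [a ea] : exists a, c = a%:P.
  by exists c`_0; apply: size1_polyC; rewrite (eqP (_ : size c == 1%N)) -?dvdp1.
have a0 : a != 0 by move: c0; rewrite ea polyC_eq0.
pose d := r' * e.
have ed : cst e = cst r * cst d by rewrite -cstM /d mulrA rr' mul1r.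
have md : motion_lin p d.
  have tF : F %| trq (cst e * conjq X * conjq (cst r)).
    have : F %| trq (D * conjq Q) by rewrite tD.
    have -> : D * conjq Q = F *: (D1 * conjq Q1 + cst e * conjq K)
        + cst e * conjq X * conjq (cst r).
      rewrite eQ conjqM mulrA {1}eD mulrDl -mulrA mulq_conjr eF.
      rewrite mulrDl -!scalerAr mulr1 -scalerAl scalerDr -addrA; congr (_ + _).
      rewrite eQ1 [conjq (K * _ + _)]conjqD [conjq (K * _)]conjqM conjqK mulrDr.
      congr (_ + _).
      rewrite !mulrA -[cst e * _ * _]mulrA mulq_conjl eF.
      by rewrite -scalerAr mulr1 -scalerAl.
    by rewrite trqD dvdp_addr // trqZ dvdp_mulIl.
  rewrite trqC mulrA -cst_conj -cstM /X lin_conj in tF.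
  have := trq_lin_const _ tF; rewrite sF => /(_ isT).
  rewrite cstM ed cst_conj.
  rewrite mulrA mulq_conjl -!scalerAl mul1r trqZ => /eqP.
  rewrite mulf_eq0 qnorm_cst polyC_eq0 qnorm_eq0 => /orP[/eqP r0|/eqP].
    by move/eqP: rr'; rewrite r0 mul0r eq_sym oner_eq0.
  by rewrite /motion_lin -lin_conj -trq_conj conjqM conjqK.
pose d1 := - (a^-1 *: d).
have ed1 : c *: cst d1 = - cst d.
  rewrite /d1 ea; apply: quatE => /=;
  by rewrite -polyCM ?polyCN mulrN mulrA divff // mul1r ?polyCN.
have md1 : motion_lin p d1.
  apply: (mulfI c0); rewrite mulr0 -trqZ scalerAr -conjqZ ed1 conjqN mulrN trqN.
  by rewrite md oppr0.
have eD' : D = (D1 - K * cst d) * X - c *: Q1 * cst d1.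
  rewrite -scalerAl scalerAr ed1 mulrN opprK eQ1 !mulrDl -ed mulNr -!mulrA.
  by rewrite (motion_lin_commute md) addrA subrK.
exists c, Q1, (D1 - K * cst d), (Dual p d1); split=> //; last first.
  by rewrite mulr_dlin /= -/X -eD' eQ scalerAl.
rewrite eQ in pQ; split=> //; first exact: primitiveq_mull pQ.
- by apply: (@coprime_dual_split _ _ Q1 X _ (cst d1)); rewrite -eD'.
- by apply: (@trq_split _ c _ X _ (cst d1)) => //; rewrite ?eF // -eD' -eQ.
move=> g [gc _ _]; apply: dvdp_trans (dvd1p _).
by rewrite -[1]mulr1; apply: dvdp_mul => //; apply: dvdp_trans c1.
Qed.

Lemma splittable_conj c Q D :
  splittable c Q D -> splittable c (conjq Q) (conjq D).
Proof.
move=> [rc pQ rD tD nc]; split=> //.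
- exact: primitiveq_conj.
- by move=> G Gc /dvdq_conj; rewrite conjqK; apply: rD.
- by rewrite trqC -conjqM trq_conj.
move=> g [gc gl gr]; rewrite qnorm_conj; apply: nc; split=> //.
  by move/dvdq_conj: gr; rewrite conjqM !conjqK.
by move/dvdq_conj: gl; rewrite conjqM !conjqK.
Qed.

(** Conjugation exchanges left and right factors. It is needed when F divides
    D conj Q but not conj Q D, and when F g divides both c and D conj Q for
    the greatest common divisor g: then F g does not divide conj Q D. *)
Lemma one_sided_step c Q D : splittable c Q D -> (1 < size (qnorm (c *: Q)))%N ->
  right_step c Q D \/ right_step c (conjq Q) (conjq D).
Proof.
move=> hs; have [rc pQ rD tD nc] := hs; have hs' := splittable_conj hs.
have c0 := noroot_neq0 rc; have N0 := noroot_neq0 (noroot_qnorm pQ).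
have [sc|sc] := ltnP 1%N (size c); last first.
  have c1 : c %| 1 by rewrite dvdp1 eqn_leq sc size_poly_gt0.
  have [a ea] : exists a, c = a%:P by exists c`_0; apply: size1_polyC.
  have -> : size (qnorm (c *: Q)) = size (qnorm Q).
    rewrite qnormZ ea -rmorphXn /= mul_polyC size_scale //.
    by rewrite expf_neq0 // -polyC_eq0 -ea.
  move=> sN; left.
  have [F [mF sF irrF FN]] := noroot_quadratic (noroot_qnorm pQ) sN.
  exact: right_step_const hs mF sF irrF c1 FN.
move=> _; have [F [mF sF irrF Fc]] := noroot_quadratic rc sc.
have [Fr|nFr] := pselect (dvdq F (D * conjq Q)); last first.
  by left; apply: right_step_removable hs mF sF irrF Fc nFr.
have [Fl|nFl] := pselect (dvdq F (conjq Q * D)); last first.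
  right; apply: (right_step_removable hs' mF sF irrF Fc).
  by move/dvdq_conj; rewrite conjqM !conjqK.
pose g := gcdp c (gcdp (content (conjq Q * D)) (content (D * conjq Q))).
have gP g' : common_divisor c Q D g' <-> g' %| g.
  rewrite [_ %| g]dvdp_gcd [_ %| gcdp (content _) _]dvdp_gcd.
  split=> [[-> /dvdq_content -> /dvdq_content ->] //|].
  by move=> /andP[? /andP[? ?]]; split=> //; apply/dvdq_content.
have cg : common_divisor c Q D g by apply/gP.
have maxg g' : common_divisor c Q D g' -> g' %| g by move/gP.
have Fg : F %| g by apply/gP.
have [h|h] := pselect (~ dvdq (F * g) (D * conjq Q) \/ ~ F * g %| c).
  by left; apply: right_step_shift hs mF sF irrF cg maxg Fg h.
have {h} [h1 h2] : dvdq (F * g) (D * conjq Q) /\ F * g %| c.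
  by split; apply: contrapT => n; apply: h; [left|right].
have g0 : g != 0 by rewrite gcdp_eq0 negb_and c0.
have h3 : ~ dvdq (F * g) (conjq Q * D).
  move=> h3; have /gP/dvdp_leq : common_divisor c Q D (F * g) by [].
  move/(_ g0); rewrite (size_mul (irredp_neq0 irrF) g0) sF /= => hs3.
  have : (0 < size g)%N by rewrite size_poly_gt0.
  by lia.
right; apply: (@right_step_shift _ _ _ _ F g) => //.
- case: cg => gc gl gr; split=> //; rewrite ?conjqK.
    by move/dvdq_conj: gr; rewrite conjqM conjqK.
  by move/dvdq_conj: gl; rewrite conjqM conjqK.
- move=> g' [gc gl gr]; apply: maxg; split=> //.
    by move/dvdq_conj: gr; rewrite conjqM !conjqK.
  by move/dvdq_conj: gl; rewrite conjqM !conjqK.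
by left=> /dvdq_conj; rewrite conjqM !conjqK.
Qed.

End Splitting.

(** * The condition suffices *)

Section Factorization.
Variable R : rcfType.
Implicit Types (c F G g : {poly R}) (Q D X : quat {poly R}) (h : dquat R).
Import Num.Theory Order.TTheory.

Lemma conjdM (A : comNzRingType) (x y : dquat A) :
  conjd (x * y) = conjd y * conjd x.
Proof.
case: x y => [p d] [p' d']; congr Dual => /=; first exact: conjqM.
by rewrite conjqD !conjqM addrC.
Qed.

Lemma conjd_dlin h : conjd (dlin h) = dlin (conjd h).
Proof. by rewrite /dlin /conjd /= lin_conj conjqN cst_conj. Qed.

Lemma motion_dlin_conj h : motion_dlin h -> motion_dlin (conjd h).
Proof.
case: h => p d; rewrite /motion_dlin /motion_lin /= => m.
by rewrite -lin_conj cst_conj -conjqM trq_conj trqC.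
Qed.

Lemma conjd_prod (s : seq (dquat R)) :
  conjd (\prod_(h <- s) dlin h) = \prod_(h <- rev (map (@conjd R) s)) dlin h.
Proof.
elim: s => [|h s IH].
  by rewrite !big_nil; congr Dual; apply: quatE; rewrite /= ?oppr0.
by rewrite big_cons conjdM IH map_cons rev_cons big_rcons conjd_dlin.
Qed.

(** Linear factors on both sides of a cofactor whose primal part has constant
    norm. The cofactor stays in the middle since its dual part is not bounded
    in degree. *)
Definition splits (m : dquat {poly R}) : Prop := exists s1 u s2,
  [/\ forall h, h \in s1 ++ s2 -> motion_dlin h,
      m = (\prod_(h <- s1) dlin h) * u * (\prod_(h <- s2) dlin h)
    & (size (qnorm (primal u)) <= 1)%N].

Lemma splits_mulr m h : splits m -> motion_dlin h -> splits (m * dlin h).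
Proof.
move=> [s1 [u [s2 [ms -> su]]]] mh; exists s1, u, (rcons s2 h); split=> //.
  move=> h'; rewrite mem_cat mem_rcons inE orbCA => /orP[/eqP -> //|h's].
  by apply: ms; rewrite mem_cat.
by rewrite big_rcons -!mulrA.
Qed.

Lemma splits_conj m : splits m -> splits (conjd m).
Proof.
move=> [s1 [u [s2 [ms -> su]]]].
exists (rev (map (@conjd R) s2)), (conjd u), (rev (map (@conjd R) s1)); split.
- move=> h; rewrite -rev_cat mem_rev -map_cat => /mapP[h' h's ->].
  exact/motion_dlin_conj/ms.
- by rewrite !conjdM !conjd_prod mulrA.
by rewrite /= qnorm_conj.
Qed.

Theorem splittable_splits c Q D : splittable c Q D -> splits (Dual (c *: Q) D).
Proof.
have [n] := ubnP (size (qnorm (c *: Q))); elim: n c Q D => // n IH c Q D.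
rewrite ltnS => sN hs.
have [s1|s1] := leqP (size (qnorm (c *: Q))) 1.
  exists [::], (Dual (c *: Q) D), [::]; split=> //.
  by rewrite big_nil mul1r mulr1.
have right Q' D' :
    qnorm Q' = qnorm Q -> right_step c Q' D' -> splits (Dual (c *: Q') D').
  move=> eN [c' [Q2 [D2 [h [mh hs' e]]]]]; rewrite e; apply: splits_mulr => //.
  apply: IH => //; apply: leq_trans sN.
  have -> : qnorm (c *: Q) = qnorm (c *: Q') by rewrite !qnormZ eN.
  have /= -> := congr1 (@primal _) e.
  rewrite qnormM size_mul ?size_qnorm_lin; last 2 first.
  - rewrite qnormZ mulf_neq0 // ?expf_neq0 //; case: hs' => rc pQ _ _ _.
      exact: noroot_neq0.
    exact/noroot_neq0/noroot_qnorm.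
  - by rewrite -size_poly_gt0 size_qnorm_lin.
  by rewrite addn3 /= ltnS leqnSn.
have [|hr] := one_sided_step hs s1; first exact: right.
have := splits_conj (right _ _ (qnorm_conj Q) hr).
by rewrite /conjd /= conjqZ !conjqK.
Qed.

End Factorization.

(** * From quaternions over R[t] to polynomials over the quaternions *)

Section Transfer.
Variable R : rcfType.
Implicit Types (c F G g : {poly R}) (x y : quat {poly R}) (P D : {poly quat R}).
Implicit Types (h : dquat R) (m : dquat {poly R}) (M : {poly dquat R}).
Import Num.Theory Order.TTheory.

(** The inverse of qcoords, which identifies polynomials over the quaternions
    with quaternions over the real polynomials. *)
Definition polyq x : {poly quat R} :=
  \poly_(i < maxn (maxn (size (q0 x)) (size (q1 x)))
                  (maxn (size (q2 x)) (size (q3 x))))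
    Quat (q0 x)`_i (q1 x)`_i (q2 x)`_i (q3 x)`_i.

Definition qcoords P : quat {poly R} :=
  Quat (map_poly (@q0 R) P) (map_poly (@q1 R) P)
       (map_poly (@q2 R) P) (map_poly (@q3 R) P).

Lemma coef_polyq x i :
  (polyq x)`_i = Quat (q0 x)`_i (q1 x)`_i (q2 x)`_i (q3 x)`_i.
Proof.
rewrite coef_poly; case: ltnP => //; rewrite !geq_max.
by move=> /andP[/andP[? ?] /andP[? ?]]; rewrite !nth_default.
Qed.

Lemma polyq_inj : injective polyq.
Proof.
move=> x y e; have {}e i := congr1 (fun P : {poly quat R} => P`_i) e.
by apply: quatE; apply/polyP => i; have := e i; rewrite !coef_polyq => -[].
Qed.

Lemma qcoordsK : cancel qcoords polyq.
Proof.
move=> P; apply/polyP => i; rewrite coef_polyq !coef_map_id0 //.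
by case: (P`_i).
Qed.

Lemma polyqM x y : polyq (x * y) = polyq x * polyq y.
Proof.
apply/polyP => i; rewrite coefM coef_polyq.
under eq_bigr => j _ do rewrite !coef_polyq.
have qsum (f : quat R -> R) : {morph f : a b / a + b} -> f 0 = 0 ->
    forall F : 'I_i.+1 -> quat R, f (\sum_j F j) = \sum_j f (F j).
  by move=> fD f0 F; rewrite (big_morph f fD f0).
apply: quatE; rewrite qsum //= ?(coefD, coefB, coefN) !coefM.
all: by rewrite -?sumrN -?big_split.
Qed.

Lemma polyq1 : polyq 1 = 1.
Proof.
apply/polyP => i; rewrite coef_polyq coef1.
by case: i => [|i]; apply: quatE; rewrite /= ?coef0 ?coef1.
Qed.

Lemma polyqZ F x : polyq (F *: x) = rpoly F * polyq x.
Proof.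
rewrite -[x in LHS]mul1r scalerAl polyqM; congr (_ * _); apply/polyP => i.
rewrite coef_polyq coef_map /= mulr1 mulr0 coef0.
by apply: quatE; rewrite /= ?mulr1 ?mulr0.
Qed.

Lemma polyq_conj x : conjpq (polyq x) = polyq (conjq x).
Proof.
apply/polyP => i; rewrite coef_map_id0 ?coef_polyq /conjq /= ?coefN //.
by apply: quatE; rewrite /= ?oppr0.
Qed.

Lemma rdvd_polyq F x : rdvd F (polyq x) <-> dvdq F x.
Proof.
split=> [[P]|[y ->]]; last by exists (polyq y); rewrite polyqZ.
rewrite -(qcoordsK P) -polyqZ => /polyq_inj ->.
by exists (qcoords P).
Qed.

Lemma dvdq_real F G : dvdq F G%:A <-> F %| G.
Proof.
by rewrite dvdqP /= mulr1 mulr0 dvdp0; split=> [[]|].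
Qed.

Lemma polyq_real F : polyq F%:A = rpoly F.
Proof. by rewrite polyqZ polyq1 mulr1. Qed.

Lemma coef_dual_poly P D i : (dual_poly P D)`_i = Dual P`_i D`_i.
Proof.
rewrite /dual_poly coefD coefCM !coef_map_id0 //.
by congr Dual => /=; rewrite ?mul0r ?addr0 ?mulr0 ?mul1r ?add0r.
Qed.

Definition polyd m : {poly dquat R} :=
  dual_poly (polyq (primal m)) (polyq (dualp m)).

Lemma polyd_inj : injective polyd.
Proof.
move=> [p d] [p' d'] e.
have {}e i := congr1 (fun M : {poly dquat R} => M`_i) e.
by congr Dual; apply: polyq_inj; apply/polyP => i; have := e i;
  rewrite !coef_dual_poly => -[].
Qed.

Lemma polydM m m' : polyd (m * m') = polyd m * polyd m'.
Proof.
apply/polyP => i; rewrite coefM coef_dual_poly /=.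
under eq_bigr => j _ do rewrite !coef_dual_poly.
have dsum (f : dquat R -> quat R) : {morph f : a b / a + b} -> f 0 = 0 ->
    forall F : 'I_i.+1 -> dquat R, f (\sum_j F j) = \sum_j f (F j).
  by move=> fD f0 F; rewrite (big_morph f fD f0).
have dualE (a b : dquat R) : primal a = primal b -> dualp a = dualp b -> a = b.
  by case: a b => [? ?] [? ?] /= -> ->.
apply: dualE; rewrite dsum //=.
  by rewrite polyqM coefM.
have -> : polyq (primal m * dualp m' + dualp m * primal m') =
    polyq (primal m * dualp m') + polyq (dualp m * primal m').
  by apply/polyP => j; rewrite coefD !coef_polyq; apply: quatE; rewrite /= coefD.
by rewrite !polyqM coefD !coefM -big_split.
Qed.

Lemma polyd_real F : polyd (Dual F%:A 0) = rpoly F.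
Proof.
apply/polyP => i; rewrite coef_dual_poly coef_map !coef_polyq /= mulr1 mulr0 coef0.
by congr Dual; apply: quatE; rewrite /= ?mulr1 ?mulr0.
Qed.

Lemma polyd1 : polyd 1 = 1.
Proof.
have -> : 1 = Dual (1%:A) 0 :> dquat {poly R} by rewrite scale1r.
by rewrite polyd_real /rpoly rmorph1.
Qed.

Lemma polyd_conj m : conjpd (polyd m) = polyd (conjd m).
Proof.
apply/polyP => i; rewrite coef_map_id0; last first.
  by congr Dual; apply: quatE; rewrite /= ?oppr0.
rewrite !coef_dual_poly !coef_polyq.
by congr Dual; apply: quatE; rewrite /= ?coefN.
Qed.

Lemma polyd_dlin h : polyd (dlin h) = 'X - h%:P.
Proof.
apply/polyP => i; rewrite /dlin linE coef_dual_poly !coef_polyq /=.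
rewrite !coefB !coefN !coefX !coefC.
by case: h => [[????] [????]]; case: i => [|[|i]]; congr Dual; apply: quatE;
  rewrite /= ?subr0 ?sub0r ?oppr0.
Qed.

Lemma polyd_prod (s : seq (dquat R)) :
  polyd (\prod_(h <- s) dlin h) = \prod_(h <- s) ('X - h%:P).
Proof.
rewrite (big_morph polyd polydM polyd1).
by apply: eq_bigr => h _; rewrite polyd_dlin.
Qed.

Lemma mul_conjd m : m * conjd m = Dual (qnorm (primal m))%:A
  (trq (primal m * conjq (dualp m)))%:A.
Proof.
congr Dual; rewrite /= ?mulq_conjr // -add_conjq.
by rewrite conjqM conjqK.
Qed.

Lemma motion_polyd m : qnorm (primal m) != 0 ->
  (exists N : {poly R}, N != 0 /\ polyd m * conjpd (polyd m) = rpoly N) <->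
  trq (primal m * conjq (dualp m)) = 0.
Proof.
move=> N0; rewrite polyd_conj -polydM mul_conjd; split.
  move=> [N [_]]; rewrite -polyd_real => /polyd_inj/(congr1 (@dualp _)).
  by move/(congr1 (@q0 _)); rewrite /= mulr1.
by move=> ->; exists (qnorm (primal m)); rewrite scale0r polyd_real.
Qed.

Lemma motion_dlinP h :
  (exists N : {poly R}, N != 0 /\
     ('X - h%:P) * conjpd ('X - h%:P) = rpoly N) <-> motion_dlin h.
Proof.
rewrite -polyd_dlin motion_polyd /=; last exact/monic_neq0/monic_qnorm_lin.
rewrite /motion_dlin /motion_lin conjqN mulrN trqN; split=> [/eqP|->].
  by rewrite oppr_eq0 => /eqP.
by rewrite oppr0.
Qed.

Lemma monic_prod_lin (s : seq (dquat R)) :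
  \prod_(h <- s) ('X - h%:P) \is monic /\
  size (\prod_(h <- s) ('X - h%:P)) = (size s).+1.
Proof.
elim: s => [|h s [mIH sIH]]; first by rewrite big_nil monic1 size_poly1.
rewrite big_cons; split; first by rewrite rpredM ?monicXsubC.
by rewrite size_monicM ?monicXsubC ?monic_neq0 // size_XsubC sIH.
Qed.

(** The leading coefficient 1 of polyd u comes from the primal part; so if u
    were not constant, its primal part would have a nonconstant norm. *)
Lemma monic_constant_norm u : polyd u \is monic ->
  (size (qnorm (primal u)) <= 1)%N -> polyd u = 1.
Proof.
move=> mU sN; set U := polyd u in mU *; set V := polyq (primal u).
have eV i : V`_i = primal U`_i by rewrite coef_dual_poly.
have V1 : V`_(size U).-1 = 1 by rewrite eV -lead_coefE (monicP mU).
have sU : (0 < size U)%N by rewrite size_poly_gt0 monic_neq0.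
have sV : size V = size U.
  apply/eqP; rewrite eqn_leq; apply/andP; split.
    by apply/leq_sizeP => j sj; rewrite eV nth_default.
  rewrite leqNgt; apply/negP => sVU; move/eqP: V1.
  by rewrite nth_default ?(eq_sym 0) ?oner_eq0 // -ltnS prednK.
have mV : V \is monic by rewrite monicE lead_coefE sV V1.
set W := polyq (conjq (primal u)).
have sW : (size V <= size W)%N.
  have W1 : W`_(size V).-1 = 1.
    rewrite coef_polyq /= !coefN -[RHS]conjq1 -V1 sV coef_polyq.
    by apply: quatE.
  rewrite leqNgt; apply/negP => sWV; move/eqP: W1.
  by rewrite nth_default ?(eq_sym 0) ?oner_eq0 // -ltnS prednK // sV.
have : (size (V * W)%R <= 1)%N.
  rewrite -polyqM mulq_conjr polyqZ (size1_polyC sN).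
  by rewrite polyq1 mulr1 /rpoly map_polyC size_polyC_leq1.
rewrite size_monicM //; last by rewrite -size_poly_gt0 (leq_trans _ sW) // sV.
rewrite sV in sW *; move=> hs; have {hs} s1 : size U = 1%N by lia.
have eU : U = (U`_0)%:P by apply: size1_polyC; rewrite s1.
have U0 : U`_0 = 1 by move: (monicP mU); rewrite lead_coefE s1.
rewrite -[LHS]/U [LHS]eU U0; exact: polyC1.
Qed.

End Transfer.

(** * The theorem *)

Lemma grpd_common_divisor (R : realType) (c g : {poly R}) (x y : quat {poly R}) :
    is_grpd [:: rpoly c; conjpq (polyq x) * polyq y;
      polyq y * conjpq (polyq x)] g ->
  common_divisor c x y g /\ forall g', common_divisor c x y g' -> g' %| g.
Proof.
rewrite polyq_conj -!polyqM -polyq_real => -[_ dg maxg]; split.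
  split; first by apply/dvdq_real/rdvd_polyq/dg; rewrite !inE eqxx.
    by apply/rdvd_polyq/dg; rewrite !inE eqxx orbT.
  by apply/rdvd_polyq/dg; rewrite !inE eqxx !orbT.
move=> g' [gc gl gr]; apply: maxg => P.
by rewrite !inE => /or3P[] /eqP ->; apply/rdvd_polyq => //; apply/dvdq_real.
Qed.

Theorem theorem1 (R : realType) (M : {poly dquat R}) (c : {poly R})
    (Q D : {poly quat R}) (g : {poly R})
    (M_def : M = dual_poly (rpoly c * Q) D)
    (M_bounded : bounded M)
    (M_const : forall F : {poly R}, rdvd F M -> (size F <= 1)%N)
    (Q_const : forall F : {poly R}, rdvd F Q -> (size F <= 1)%N)
    (g_gcd : is_grpd [:: rpoly c; conjpq Q * D; D * conjpq Q] g) :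
  (exists h : 'I_(size M).-1 -> dquat R,
      M = \prod_(i < (size M).-1) ('X - (h i)%:P)
      /\ forall i, motion_poly ('X - (h i)%:P))
  <-> rdvd (c * g) (D * conjpq D).
Proof.
case: M_bounded => mM _ motM bM.
have [x eQ] : exists x, Q = polyq x by exists (qcoords Q); rewrite qcoordsK.
have [y eD] : exists y, D = polyq y by exists (qcoords D); rewrite qcoordsK.
subst Q D; rewrite -polyqZ in M_def.
have eM : M = polyd (Dual (c *: x) y) by [].
have P0 : c *: x != 0.
  apply/eqP => P0; have := monicP mM; rewrite lead_coefE eM coef_dual_poly /= P0.
  rewrite coef_polyq /= !coef0 => /(congr1 (fun a => q0 (primal a))) /eqP /=.
  by rewrite eq_sym oner_eq0.
have c0 : c != 0 by apply: contraNneq P0 => ->; rewrite scale0r.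
have x0 : x != 0 by apply: contraNneq P0 => ->; rewrite scaler0.
have unit_of (F : {poly R}) : F != 0 -> (size F <= 1)%N -> F %| 1.
  by move=> F0 sF; rewrite dvdp1 eqn_leq sF size_poly_gt0.
have px : primitiveq x.
  move=> F Fx; apply: unit_of; last exact/Q_const/rdvd_polyq.
  by case: Fx => z ex; apply: contraNneq x0 => F0; rewrite ex F0 scale0r.
have rc : noroot c.
  move=> r; apply: contra (bM r) => rr.
  have eP : primal_part M = polyq (c *: x).
    by apply/polyP => i; rewrite coef_map_id0 // eM coef_dual_poly.
  have /mrpfP[_ _ hP] : primal_part M != 0.
    apply: contraNneq P0 => e; apply/eqP/polyq_inj; rewrite -eP e.
    by apply/polyP => i; rewrite coef_polyq /= !coef0.
  rewrite -dvdp_XsubCl; apply: dvdp_trans (hP c _); first by rewrite dvdp_XsubCl.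
  move=> P; rewrite inE eP => /eqP ->; apply/rdvd_polyq; by exists x.
have rD : coprime_dual c y.
  move=> F /dvdpP[c' ec] [z ey].
  apply: unit_of; first by apply: contraNneq c0 => F0; rewrite ec F0 mulr0.
  apply: M_const; exists (polyd (Dual (c' *: x) z)).
  rewrite -polyd_real -polydM eM; congr polyd; congr Dual => /=.
    by rewrite -scalerAl mul1r scalerA mulrC -ec.
  by rewrite mul0r addr0 -scalerAl mul1r.
have tD : trq (y * conjq x) = 0.
  have /motion_polyd : exists N : {poly R}, N != 0 /\
      polyd (Dual (c *: x) y) * conjpd (polyd (Dual (c *: x) y)) = rpoly N.
    by rewrite -eM.
  rewrite /= -scalerAl trqZ.
  rewrite qnormZ mulf_neq0 ?expf_neq0 //; last exact/noroot_neq0/noroot_qnorm.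
  move=> /(_ isT)/eqP; rewrite mulf_eq0 (negPf c0) => /eqP.
  by rewrite -trq_conj conjqM conjqK.
have [cg maxg] := grpd_common_divisor g_gcd.
have -> : rdvd (c * g) (polyq y * conjpq (polyq y)) <-> c * g %| qnorm y.
  by rewrite polyq_conj -polyqM mulq_conjr rdvd_polyq dvdq_real.
split=> [[h [eMh mh]]|cgy].
  apply: (@norm_condition_prod _ [seq h i | i <- index_enum _] c x y) => //.
    move=> _ /mapP[i _ ->]; by have := mh i; move/motion_dlinP.
  by apply: polyd_inj; rewrite polyd_prod big_map -eM.
have : splits (Dual (c *: x) y).
  apply: splittable_splits; split=> // g' /maxg g'g.
  by apply: dvdp_trans cgy; rewrite dvdp_mul2l.
case=> [s1 [u [s2 [ms em su]]]].
have {}em : M = \prod_(h <- s1) ('X - h%:P) * polyd u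
    * \prod_(h <- s2) ('X - h%:P).
  by rewrite eM em !polydM !polyd_prod.
have u1 : polyd u = 1.
  have [m1 _] := monic_prod_lin s1; have [m2 _] := monic_prod_lin s2.
  apply: (monic_constant_norm _ su); rewrite monicE; apply/eqP.
  by rewrite -(lead_coef_monicM _ m1) -(lead_coef_Mmonic _ m2) -em (monicP mM).
have {}em : M = \prod_(h <- s1 ++ s2) ('X - h%:P).
  by rewrite em u1 mulr1 big_cat.
have sM : (size M).-1 = size (s1 ++ s2).
  by rewrite em; have [_ ->] := monic_prod_lin (s1 ++ s2).
exists (fun i => nth 0 (s1 ++ s2) i); split.
  by rewrite sM {1}em (big_nth 0) big_mkord.
move=> i; apply/motion_dlinP/ms/mem_nth; rewrite -sM; exact: ltn_ord.
Qed.
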